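(* A connected cubic graph $G$ of order $n$ satisfies $\gamma_{\rm gr}(G)=\frac{n}{2}$ if and only if $G$ is isomorphic to one of the graphs $K_{3,3}$, $Y_2$, $Y_3$, $N_{YY}$, $K_3\,\square\,K_2$, $Q_3$, $TQ_3$, or the Petersen graph.
   Context: Graphs are finite and simple; the order is the number of vertices; cubic means 3-regular. $N_G[v]$ is the closed neighborhood of $v$ (its neighbors together with $v$). A sequence $(v_1,\ldots,v_m)$ of vertices of $G$ is a closed neighborhood sequence if for every $i\in\{2,\ldots,m\}$, $N_G[v_i]\setminus\bigcup_{j=1}^{i-1}N_G[v_j]\neq\emptyset$. The Grundy domination number $\gamma_{\rm gr}(G)$ is the maximum length of a closed neighborhood sequence in $G$. The graph $Y$ is obtained from $K_{2,3}$ by adding an edge between two vertices of degree 2; it has a unique vertex of degree 2, denoted $\alpha_Y$. $Y_2$ is the disjoint union of two copies of $Y$ together with an edge joining their degree-2 vertices. $Y_3$ is obtained from the star $K_{1,3}$ by identifying each of its three leaves with the degree-2 vertex of its own copy of $Y$. $N_{YY}$ is the cubic graph on 8 vertices obtained from two disjoint diamonds (a diamond is $K_4$ minus an edge, and has exactly two vertices of degree 2) by adding two disjoint edges, each joining a degree-2 vertex of one diamond to a degree-2 vertex of the other. $K_3\,\square\,K_2$ is the Cartesian product (the prism), and $Q_3$ is the 3-cube. $TQ_3$ (twisted cube) is obtained from two disjoint 4-cycles $a,b,c,d,a$ and $a',b',c',d',a'$ by adding the edges $aa'$, $bb'$, $cd'$, $dc'$. *)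

(* Defs.v *)
From mathcomp Require Import all_boot.

Set Implicit Arguments.
Unset Strict Implicit.
Unset Printing Implicit Defensive.

Record sgraph := SGraph {
  vertex :> finType;
  edge : rel vertex;
  edge_sym : symmetric edge;
  edge_irrefl : irreflexive edge }.

Definition degree (G : sgraph) (x : G) : nat := #|[set y | edge x y]|.

Definition cubic (G : sgraph) : Prop := forall x : G, degree x = 3.

(* The graph with no vertex is not connected. *)
Definition connected (G : sgraph) : Prop :=
  0 < #|G| /\ forall x y : G, connect (@edge G) x y.

Definition graph_iso (G H : sgraph) : Prop :=
  exists f : G -> H, bijective f /\ forall x y, edge (f x) (f y) = edge x y.

Definition closed_nbhd (G : sgraph) (x : G) : {set G} :=
  [set y | (y == x) || edge x y].

(* Indices start at 0, so no condition is put on the vertex of index 0. *)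
Definition closed_nbhd_seq (G : sgraph) (m : nat) (v : m.-tuple G) : bool :=
  [forall i : 'I_m, (0 < i) ==>
    (closed_nbhd (tnth v i)
       :\: \bigcup_(j < m | j < i) closed_nbhd (tnth v j) != set0)].

(* Bounding m by the order loses no sequence: see [gamma_gr_max] below. *)
Definition gamma_gr (G : sgraph) : nat :=
  \max_(m < #|G|.+1 | [exists v : m.-tuple G, closed_nbhd_seq v]) m.

Lemma closed_nbhd_seq_uniq (G : sgraph) m (v : m.-tuple G) :
  closed_nbhd_seq v -> uniq v.
Proof.
move=> /forallP vP; apply/tuple_uniqP => i j.
have neq (k l : 'I_m) : k < l -> tnth v k <> tnth v l.
  move=> kl eq_v; have /implyP/(_ (leq_ltn_trans (leq0n k) kl)) := vP l.
  case/set0Pn=> x; rewrite in_setD -eq_v => /andP[/bigcupP x_new x_k].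
  by apply: x_new; exists k.
by move=> eq_v; case: (ltngtP i j) => [/neq|/neq/nesym|/val_inj].
Qed.

Lemma gamma_gr_max (G : sgraph) m (v : m.-tuple G) :
  closed_nbhd_seq v -> m <= gamma_gr G.
Proof.
move=> vP; have m_le : m < #|G|.+1.
  rewrite ltnS -(size_tuple v) -(card_uniqP (closed_nbhd_seq_uniq vP)).
  exact: max_card.
apply: (leq_bigmax_cond (Ordinal m_le)).
by apply/existsP; exists v.
Qed.

Lemma gamma_gr_attained (G : sgraph) :
  exists v : (gamma_gr G).-tuple G, closed_nbhd_seq v.
Proof.
have P0 : [exists v : 0.-tuple G, closed_nbhd_seq v].
  by apply/existsP; exists [tuple]; apply/forallP; case.
rewrite /gamma_gr (bigmax_eq_arg ord0) //.
by case: arg_maxnP => // m /existsP.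
Qed.

Section Simple.
Variables (T : finType) (r : rel T).

Definition simple_rel : rel T := fun x y => (x != y) && (r x y || r y x).

Fact simple_rel_sym : symmetric simple_rel.
Proof. by move=> x y; rewrite /simple_rel eq_sym orbC. Qed.

Fact simple_rel_irrefl : irreflexive simple_rel.
Proof. by move=> x; rewrite /simple_rel eqxx. Qed.

(* The graph whose edges are the pairs {x, y} with x != y related by r in at
   least one direction. *)
Definition graph_of : sgraph := SGraph simple_rel_sym simple_rel_irrefl.

End Simple.

Definition empty_graph (n : nat) : sgraph := @graph_of 'I_n (fun _ _ => false).

Definition complete_graph (n : nat) : sgraph := @graph_of 'I_n (fun _ _ => true).

Definition cycle_graph (n : nat) : sgraph :=
  @graph_of 'I_n (fun i j => j == ordS i).

Definition add_edge (G : sgraph) (u v : G) : sgraph :=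
  graph_of (fun x y : G => edge x y || (x == u) && (y == v)).

Definition delete_edge (G : sgraph) (u v : G) : sgraph :=
  graph_of (fun x y : G =>
    edge x y && ~~ ((x == u) && (y == v) || (x == v) && (y == u))).

(* Disjoint union of G and H, together with the edges xy for x in G and y in H
   such that c x y. *)
Definition join_by (G H : sgraph) (c : G -> H -> bool) : sgraph :=
  @graph_of (G + H)%type (fun x y =>
    match x, y with
    | inl a, inl b => edge a b
    | inr a, inr b => edge a b
    | inl a, inr b => c a b
    | inr _, inl _ => false
    end).

Definition cartesian_product (G H : sgraph) : sgraph :=
  @graph_of (G * H)%type (fun x y =>
    (x.1 == y.1) && edge x.2 y.2 || edge x.1 y.1 && (x.2 == y.2)).

Definition complete_bipartite (m n : nat) : sgraph :=
  @join_by (empty_graph m) (empty_graph n) (fun _ _ => true).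

Definition Y : sgraph :=
  @add_edge (complete_bipartite 2 3)
    (inr (@Ordinal 3 0 isT)) (inr (@Ordinal 3 1 isT)).

Definition alpha_Y : Y := inr (@Ordinal 3 2 isT).

Definition Y2 : sgraph :=
  @join_by Y Y (fun x y => (x == alpha_Y) && (y == alpha_Y)).

(* None is the centre of the star; its leaves are the Some (i, alpha_Y). *)
Definition Y3 : sgraph :=
  @graph_of (option ('I_3 * Y)) (fun x y =>
    match x, y with
    | None, Some b => b.2 == alpha_Y
    | Some a, Some b => (a.1 == b.1) && edge a.2 b.2
    | _, None => false
    end).

(* The vertices of degree 2 are 0 and 1. *)
Definition diamond : sgraph :=
  @delete_edge (complete_graph 4) (@Ordinal 4 0 isT) (@Ordinal 4 1 isT).

Definition N_YY : sgraph :=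
  @join_by diamond diamond (fun x y : 'I_4 => (x == y) && (x < 2)).

Definition prism : sgraph :=
  cartesian_product (complete_graph 3) (complete_graph 2).

Definition Q3 : sgraph :=
  cartesian_product (cartesian_product (complete_graph 2) (complete_graph 2))
    (complete_graph 2).

(* The vertices 0, 1, 2, 3 of each 4-cycle are a, b, c, d, respectively
   a', b', c', d'. *)
Definition TQ3 : sgraph :=
  @join_by (cycle_graph 4) (cycle_graph 4) (fun x y : 'I_4 =>
    (nat_of_ord x, nat_of_ord y) \in [:: (0, 0); (1, 1); (2, 3); (3, 2)]).

(* The Kneser graph of the 2-element subsets of a 5-element set. *)
Definition petersen : sgraph :=
  @graph_of {A : {set 'I_5} | #|A| == 2} (fun A B =>
    [disjoint val A & val B]).

(* Main.v *)
Require Import Defs.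
From mathcomp Require Import all_boot all_order all_algebra.
From mathcomp Require Import ring.

(** Let the dominated set of a sequence be the union of the closed
    neighbourhoods of its terms, and let each term gain the vertices that it
    is the first to dominate.  The first term gains four vertices.  As long as
    a dominated vertex x has an undominated neighbour, x gains at most two, as
    x has a dominated neighbour besides itself.  In a connected cubic graph
    every nonempty legal sequence S therefore extends to one that dominates
    everything without decreasing 2|S| - |dominated set| ([extend]).  If
    2 gamma = n, this number is at most 0 for every legal S ([legal_le]), and
    when it is 0 the dominated set is called tight.

    Tightness is very restrictive: no vertex may gain exactly one vertex over
    a tight set, so each vertex of a tight set D that sees the complement of D
    sees it twice, and adding its two new neighbours gives a tight set again.
    The local consequence is [star]: the two new neighbours either are the
    central pair of a diamond, or are nonadjacent and see nothing else of D.
    Following the second alternative, D is left through a branch that hangs at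
    a single vertex and looks like a binary tree; as it is finite, two of its
    arms meet in a copy of Y ([branch_closed], [branch_Y]).

    It remains to find small tight sets in G.
    - A copy of Y together with the third neighbour beta of alpha is tight.
      Two copies of Y that hang at different vertices would give a branch that
      leads nowhere ([two_Y]), hence all copies hang at beta and G is Y_2 or
      Y_3 ([contains_Y]).
    - A diamond whose ends have distinct outer neighbours p', q' is tight
      together with p' and q'.  If G contains no Y, then p' and q' are the ends
      of a second diamond, and G is N_YY ([contains_diamond]).
    - Without diamonds, a nonempty tight set is the whole vertex set
      ([tight_full]).  The vertices of a chordless cycle with distinct outer
      neighbours form a legal sequence; they dominate the cycle and these
      neighbours, which is a tight set, so there are no other vertices.  Cycles
      of length 3, 4, 5 give the prism, Q_3 and TQ_3, and the Petersen graph,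
      and coinciding outer neighbours of a 4-cycle give K_{3,3}.  A shortest
      cycle of length at least 6 is impossible, since each outer neighbour
      would need two others, and each of these adjacencies closes a shorter
      cycle unless the feet are antipodal in a 6-cycle, where antipodes are
      unique ([girth_le5]).

    Conversely, gamma is at most the rank of any matrix whose nonzero entries
    are exactly those of the adjacency matrix plus the identity, because the
    terms of a legal sequence and their footprints index a triangular
    submatrix ([gamma_gr_rank]).  For each of the eight graphs there is such
    a matrix of rank n/2 over the field with five elements. *)

Set Implicit Arguments.
Unset Strict Implicit.
Unset Printing Implicit Defensive.

(** * Closed neighbourhood sequences and their footprints *)

Section Sequences.
Variable G : sgraph.
Implicit Types (x y u v : G) (s : seq G) (f : seq (G * G)).

Lemma in_nbhd x y : (y \in closed_nbhd x) = (y == x) || edge x y.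
Proof. by rewrite inE. Qed.

Lemma nbhd_refl x : x \in closed_nbhd x.
Proof. by rewrite in_nbhd eqxx. Qed.

Lemma edge_neq x y : edge x y -> x != y.
Proof. by apply: contraTneq => ->; rewrite edge_irrefl. Qed.

Definition dominated s : {set G} := \bigcup_(x <- s) closed_nbhd x.

Lemma dominated_cons x s : dominated (x :: s) = closed_nbhd x :|: dominated s.
Proof. by rewrite /dominated big_cons. Qed.

Lemma dominated_nil : dominated [::] = set0.
Proof. by rewrite /dominated big_nil. Qed.

Lemma in_dominated s y : (y \in dominated s) = has (fun x => y \in closed_nbhd x) s.
Proof.
elim: s => [|x s IH]; first by rewrite dominated_nil inE.
by rewrite dominated_cons inE IH.
Qed.

(** Sequences are listed with the last term first, so that extending a legal
    sequence is a [cons]. *)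
Fixpoint legal s : bool :=
  if s is x :: s' then ~~ (closed_nbhd x \subset dominated s') && legal s' else true.

(** The terms of a legal sequence, last term first, each paired with a vertex
    that it is the first to dominate (its footprint).  Only [eq_op] and [edge]
    occur, so that the condition evaluates on concrete graphs. *)
Definition footprinted f : bool :=
  all (fun a => (a.2 == a.1) || edge a.1 a.2) f
  && pairwise (fun a b => ~~ ((a.2 == b.1) || edge b.1 a.2)) f.

Lemma footprinted_legal f : footprinted f -> legal (unzip1 f).
Proof.
elim: f => [|[v u] f IH] //= /andP[] /= /andP[uv fa] /andP[/allP nu fp].
rewrite IH ?andbT; last by rewrite /footprinted fa fp.
apply/subsetPn; exists u; first by rewrite in_nbhd.
rewrite in_dominated; apply/hasPn => _ /mapP[b bf ->].
by rewrite in_nbhd; apply: nu.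
Qed.

Lemma legal_footprinted s :
  legal s -> exists2 f, unzip1 f = s & footprinted f.
Proof.
elim: s => [|x s IH] /=; first by exists [::].
case/andP=> /subsetPn[u ux /negP us] /IH[f fs /andP[fa fp]].
exists ((x, u) :: f); first by rewrite /= fs.
rewrite /footprinted /= -in_nbhd ux fa fp /= andbT.
apply/allP => b bf; rewrite -in_nbhd; apply/negP => ub; apply: us.
by rewrite in_dominated; apply/hasP; exists b.1; rewrite // -fs map_f.
Qed.

Lemma dominated_take m (v : m.-tuple G) (i : 'I_m) :
  dominated (rev (take i v)) = \bigcup_(j < m | j < i) closed_nbhd (tnth v j).
Proof.
apply/setP=> y; rewrite in_dominated has_rev; apply/hasP/bigcupP.
  case=> x xt yx; have xi : index x (take i v) < i.
    by rewrite -index_mem size_take_min in xt; apply: leq_trans xt (geq_minl _ _).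
  exists (Ordinal (ltn_trans xi (ltn_ord i))) => //=.
  rewrite (tnth_nth x) /=; rewrite -[nth _ _ _](nth_take _ xi) nth_index //.
case=> j ji yj; exists (tnth v j) => //.
rewrite (tnth_nth (tnth v j)) -(nth_take _ ji) mem_nth //.
by rewrite size_takel ?ji // size_tuple ltnW.
Qed.

Lemma legal_rev_take m (v : m.-tuple G) (k : nat) : k <= m ->
  (forall i : 'I_m, i < k ->
     ~~ (closed_nbhd (tnth v i) \subset dominated (rev (take i v)))) <->
  legal (rev (take k v)).
Proof.
elim: k => [|k IH] km; first by rewrite take0; split.
pose i0 := Ordinal km.
rewrite (take_nth (tnth v i0)) ?size_tuple // rev_rcons /=.
have -> : nth (tnth v i0) v k = tnth v i0 by rewrite [RHS](tnth_nth (tnth v i0)).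
split=> [H|/andP[H0 H] i].
  by rewrite (H i0) //=; apply/(IH (ltnW km)) => i ik; apply: H; rewrite ltnW.
rewrite ltnS leq_eqVlt => /orP[/eqP ik|ik].
  by have -> : i = i0 by exact: val_inj.
by move: i ik; apply/(IH (ltnW km)).
Qed.

(** The condition at index 0, on which the two definitions differ, holds
    because a closed neighbourhood is not empty. *)
Lemma closed_nbhd_seq_legal m (v : m.-tuple G) :
  closed_nbhd_seq v <-> legal (rev v).
Proof.
have -> : rev v = rev (take m v) by rewrite take_oversize ?size_tuple.
have E := legal_rev_take v (leqnn m).
split=> [/forallP H|/E H]; last first.
  apply/forallP=> i; apply/implyP=> _; rewrite -dominated_take.
  by rewrite setD_eq0; apply: H.
apply/E => i _; have /implyP := H i; rewrite -dominated_take setD_eq0.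
case: (posnP i) => [i0 _|i_gt0 -> //].
by rewrite i0 take0 dominated_nil; apply/subsetPn; exists (tnth v i);
  rewrite ?nbhd_refl ?inE.
Qed.

Lemma legal_gamma s : legal s -> size s <= gamma_gr G.
Proof.
move=> ls; rewrite -size_rev; apply: (@gamma_gr_max _ _ (in_tuple (rev s))).
by apply/closed_nbhd_seq_legal; rewrite /= revK.
Qed.

Lemma gamma_legal : exists2 s, legal s & size s = gamma_gr G.
Proof.
have [v /closed_nbhd_seq_legal lv] := gamma_gr_attained G.
by exists (rev v); rewrite // size_rev size_tuple.
Qed.

End Sequences.

(** * Isomorphisms *)

Lemma graph_iso_sym (G H : sgraph) : graph_iso G H -> graph_iso H G.
Proof.
case=> f [[g fK gK] fE]; exists g; split; first by exists f.
by move=> x y; rewrite -fE !gK.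
Qed.

Lemma graph_iso_trans (G H K : sgraph) :
  graph_iso G H -> graph_iso H K -> graph_iso G K.
Proof.
case=> f [bf fE] [g [bg gE]]; exists (g \o f); split; first exact: bij_comp.
by move=> x y; rewrite /= gE fE.
Qed.

Lemma graph_iso_card (G H : sgraph) : graph_iso G H -> #|G| = #|H|.
Proof. by case=> f [bf _]; apply: bij_eq_card bf. Qed.

Lemma iso_gamma_le (G H : sgraph) : graph_iso G H -> gamma_gr G <= gamma_gr H.
Proof.
case=> f [bf fE]; have [s ls <-] := gamma_legal G.
have [t <- /andP[ta tp]] := legal_footprinted ls.
pose h (a : G * G) := (f a.1, f a.2).
rewrite size_map -(size_map h) -(size_map fst).
have hE (x y : G) : (f y == f x) || edge (f x) (f y) = (y == x) || edge x y.
  by rewrite fE (inj_eq (bij_inj bf)).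
apply/legal_gamma/footprinted_legal/andP; split.
  by rewrite all_map; apply: sub_all ta => a /=; rewrite hE.
by rewrite pairwise_map; apply: sub_pairwise tp => a b /=; rewrite hE.
Qed.

Lemma iso_gamma (G H : sgraph) : graph_iso G H -> gamma_gr G = gamma_gr H.
Proof.
move=> gh; apply/eqP; rewrite eqn_leq !iso_gamma_le //; exact: graph_iso_sym.
Qed.

(** * The rank bound *)

Import GRing.Theory.

(** Restricted to the terms of a legal sequence and their footprints, the
    matrix [b x *m (c y)^T] is triangular with nonzero diagonal, and it factors
    through dimension [k]. *)
Lemma gamma_gr_rank (F : fieldType) (G : sgraph) (k : nat)
    (b c : G -> 'rV[F]_k) :
  (forall x y, ((b x *m (c y)^T) ord0 ord0 != 0)%R
               = ((y == x) || edge x y)) ->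
  gamma_gr G <= k.
Proof.
move=> bc; have [s ls <-] := gamma_legal G.
have [f <- /andP[fa fp]] := legal_footprinted ls.
rewrite size_map; case: f fa fp => [//|a0 f0]; set f := a0 :: f0 => fa fp.
pose fi (i : 'I_(size f)) := nth a0 f i.
pose B := (\matrix_i b (fi i).1)%R; pose C := (\matrix_i c (fi i).2)%R.
have entry i j : (B *m C^T)%R i j = (b (fi i).1 *m (c (fi j).2)^T)%R ord0 ord0.
  by rewrite !mxE; apply: eq_bigr => t _; rewrite !mxE.
suff BC : (B *m C^T)%R \in unitmx.
  by rewrite -(mxrank_unit BC) mulmx_max_rank.
rewrite -unitmx_tr unitmxE det_trig; last first.
  apply/is_trig_mxP => i j ij; rewrite mxE entry; apply/eqP.
  rewrite -[_ == _]negbK bc.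
  by have /(pairwiseP a0) := fp; apply; rewrite ?inE ?ltn_ord.
rewrite unitfE; apply/prodf_neq0 => i _; rewrite mxE entry bc.
by have /allP := fa; apply; apply: mem_nth.
Qed.

(** * Graphs given by a list of edges *)

(** Concrete graphs on [nat] codes: adjacency is decided by computation, and a
    graph is recognised from the list of its vertices. *)
Definition coded (n : nat) (l : seq (nat * nat)) : sgraph :=
  @graph_of 'I_n (fun i j => (val i, val j) \in l).

Definition listed (l : seq (nat * nat)) (i j : nat) : bool :=
  (i != j) && (((i, j) \in l) || ((j, i) \in l)).

Lemma coded_edge n l (i j : coded n l) : edge i j = listed l i j.
Proof. by []. Qed.

Definition all_pairs (n : nat) (P : nat -> nat -> bool) : bool :=
  all (fun i => all (P i) (iota 0 n)) (iota 0 n).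

Lemma all_pairsP n P (i j : nat) : all_pairs n P -> i < n -> j < n -> P i j.
Proof.
move=> /allP H ltin ltjn.
have /allP : all (P i) (iota 0 n) by apply: H; rewrite mem_iota.
by apply; rewrite mem_iota.
Qed.

Definition dot (k : nat) (b c : seq nat) : nat :=
  sumn (mkseq (fun t => nth 0 b t * nth 0 c t) k).

(** The rank bound over the field with five elements, with the factors of the
    matrix given as lists of rows and checked by computation. *)
Lemma gamma_coded_le (n : nat) l k (b c : seq (seq nat)) :
  all_pairs n (fun i j =>
    (dot k (nth [::] b i) (nth [::] c j) %% 5 != 0)
      == ((j == i) || listed l i j)) ->
  gamma_gr (coded n l) <= k.
Proof.
move=> bc.
pose vec (s : seq (seq nat)) (x : coded n l) : 'rV['F_5]_k :=
  (\row_t (nth 0 (nth [::] s (val x)) t)%:R)%R.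
apply: (@gamma_gr_rank 'F_5 _ _ (vec b) (vec c)) => x y.
have /eqP <- := all_pairsP bc (ltn_ord x) (ltn_ord y).
rewrite mxE; under eq_bigr do rewrite !mxE -natrM.
rewrite -natr_sum -(dvdn_pcharf (pchar_Fp (isT : prime 5))); congr (~~ (_ == _)).
rewrite /dot sumnE big_map /= -[in RHS](subn0 k) big_mkord; by [].
Qed.

Lemma gamma_coded_ge (n : nat) l (f : seq (nat * nat)) :
  [&& all (fun a => a.1 < n) f, all (fun a => a.2 < n) f,
      all (fun a => (a.2 == a.1) || listed l a.1 a.2) f
    & pairwise (fun a b => ~~ ((a.2 == b.1) || listed l b.1 a.2)) f] ->
  size f <= gamma_gr (coded n l).
Proof.
case/and4P=> /allP f1 /allP f2 fa fp.
case: n f1 f2 => [|n] f1 f2.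
  by case: f f1 {f2 fa fp} => // a f /(_ a); rewrite inE eqxx => /(_ isT).
pose h (a : nat * nat) : coded n.+1 l * coded n.+1 l := (inord a.1, inord a.2).
rewrite -(size_map h) -(size_map fst).
have hE a b : a \in f -> b \in f ->
    ((h a).2 == (h b).1) || edge (h b).1 (h a).2
    = (a.2 == b.1) || listed l b.1 a.2.
  move=> af bf; rewrite -val_eqE coded_edge.
  change ((nat_of_ord (inord a.2 : 'I_n.+1) == (inord b.1 : 'I_n.+1)) ||
    listed l (inord b.1 : 'I_n.+1) (inord a.2 : 'I_n.+1)
    = (a.2 == b.1) || listed l b.1 a.2).
  by rewrite !inordK //; [apply: f1 | apply: f2].
apply/legal_gamma/footprinted_legal/andP; split.
  rewrite all_map; apply/allP => a af.
  by apply: etrans (hE a a af af) _; apply: (allP fa).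
rewrite pairwise_map; apply/(pairwiseP (0, 0)) => i j iP jP ij.
have hij := hE _ _ (mem_nth (0, 0) iP) (mem_nth (0, 0) jP).
by apply: etrans (congr1 negb hij) _; apply: (pairwiseP _ fp).
Qed.

Lemma iso_coded (H : sgraph) (x0 : H) (hs : seq H) n l :
  #|H| = n -> uniq hs -> size hs = n ->
  all_pairs n (fun i j => edge (nth x0 hs i) (nth x0 hs j) == listed l i j) ->
  graph_iso (coded n l) H.
Proof.
move=> cH us sz ed; pose f (i : coded n l) := nth x0 hs (val i).
exists f; split.
  apply: inj_card_bij; last by rewrite cH card_ord.
  move=> i j /eqP; rewrite /f nth_uniq ?sz ?ltn_ord //.
  by move/eqP/val_inj.
by move=> i j; rewrite (eqP (all_pairsP ed (ltn_ord i) (ltn_ord j))) coded_edge.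
Qed.

Definition K33_edges : seq (nat * nat) :=
  [:: (0, 3); (0, 4); (0, 5); (1, 3); (1, 4); (1, 5); (2, 3); (2, 4); (2, 5)].

(** With X = 3I - 2J one has X^2 = 9I = -I modulo 5, so the blocks I, X; -X, I
    form a matrix of rank 3, and no entry of X vanishes. *)
Lemma gamma_K33 : gamma_gr (coded 6 K33_edges) = 3.
Proof.
apply/eqP; rewrite eqn_leq; apply/andP; split.
  by apply: (@gamma_coded_le _ _ _
    [:: [:: 1; 0; 0]; [:: 0; 1; 0]; [:: 0; 0; 1]; [:: 4; 2; 2]; [:: 2; 4; 2];
        [:: 2; 2; 4]]
    [:: [:: 1; 0; 0]; [:: 0; 1; 0]; [:: 0; 0; 1]; [:: 1; 3; 3]; [:: 3; 1; 3];
        [:: 3; 3; 1]]);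
    vm_compute.
by apply: (@gamma_coded_ge _ _
  [:: (0, 5); (4, 4); (3, 3)]); vm_compute.
Qed.

Definition Y2_edges : seq (nat * nat) :=
  [:: (0, 2); (0, 3); (0, 4); (1, 2); (1, 3); (1, 4); (2, 3); (5, 7); (5, 8);
   (5, 9); (6, 7); (6, 8); (6, 9); (7, 8); (4, 9)].

(** On Y, in the order p, q, r, s, alpha, the rows (1,0,1,1,1) and (0,1,2,2,1)
    of p and q generate the others: r and s get q - p, and alpha gets 2p - q.
    So each copy contributes rank 2; the edge that joins them adds a 2 by 2
    block of ones, of rank 1. *)
Lemma gamma_Y2 : gamma_gr (coded 10 Y2_edges) = 5.
Proof.
apply/eqP; rewrite eqn_leq; apply/andP; split.
  by apply: (@gamma_coded_le _ _ _
    [:: [:: 1; 0; 1; 0; 0]; [:: 0; 1; 1; 0; 0]; [:: 4; 1; 0; 0; 0];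
        [:: 4; 1; 0; 0; 0]; [:: 2; 4; 2; 0; 0]; [:: 0; 0; 0; 1; 0];
        [:: 0; 0; 0; 0; 1]; [:: 0; 0; 0; 4; 1]; [:: 0; 0; 0; 4; 1];
        [:: 0; 0; 1; 2; 4]]
    [:: [:: 1; 0; 0; 0; 0]; [:: 0; 1; 0; 0; 0]; [:: 1; 2; 0; 0; 0];
        [:: 1; 2; 0; 0; 0]; [:: 0; 0; 1; 0; 0]; [:: 0; 0; 0; 1; 0];
        [:: 0; 0; 0; 0; 1]; [:: 0; 0; 0; 1; 2]; [:: 0; 0; 0; 1; 2];
        [:: 4; 4; 1; 1; 1]]);
    vm_compute.
by apply: (@gamma_coded_ge _ _
  [:: (5, 8); (9, 6); (4, 9); (0, 4); (2, 3)]); vm_compute.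
Qed.

Definition Y3_edges : seq (nat * nat) :=
  [:: (0, 2); (0, 3); (0, 4); (1, 2); (1, 3); (1, 4); (2, 3); (5, 7); (5, 8);
   (5, 9); (6, 7); (6, 8); (6, 9); (7, 8); (10, 12); (10, 13); (10, 14);
   (11, 12); (11, 13); (11, 14); (12, 13); (4, 15); (9, 15); (14, 15)].

(** Each copy of Y contributes rank 2, as in [gamma_Y2], and the star at the
    last vertex adds a matrix of rank 2. *)
Lemma gamma_Y3 : gamma_gr (coded 16 Y3_edges) = 8.
Proof.
apply/eqP; rewrite eqn_leq; apply/andP; split.
  by apply: (@gamma_coded_le _ _ _
    [:: [:: 1; 0; 1; 0; 0; 0; 0; 0]; [:: 0; 1; 1; 0; 0; 0; 0; 0];
        [:: 4; 1; 0; 0; 0; 0; 0; 0]; [:: 4; 1; 0; 0; 0; 0; 0; 0];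
        [:: 2; 4; 1; 0; 0; 0; 0; 1]; [:: 0; 0; 0; 1; 0; 0; 0; 0];
        [:: 0; 0; 0; 0; 1; 0; 0; 0]; [:: 0; 0; 0; 4; 1; 0; 0; 0];
        [:: 0; 0; 0; 4; 1; 0; 0; 0]; [:: 0; 0; 0; 2; 4; 0; 0; 1];
        [:: 0; 0; 0; 0; 0; 1; 0; 0]; [:: 0; 0; 0; 0; 0; 0; 1; 0];
        [:: 0; 0; 0; 0; 0; 4; 1; 0]; [:: 0; 0; 0; 0; 0; 4; 1; 0];
        [:: 0; 0; 0; 0; 0; 2; 4; 1]; [:: 0; 0; 1; 0; 0; 0; 0; 1]]
    [:: [:: 1; 0; 0; 0; 0; 0; 0; 0]; [:: 0; 1; 0; 0; 0; 0; 0; 0];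
        [:: 1; 2; 0; 0; 0; 0; 0; 0]; [:: 1; 2; 0; 0; 0; 0; 0; 0];
        [:: 0; 0; 1; 0; 0; 0; 0; 0]; [:: 0; 0; 0; 1; 0; 0; 0; 0];
        [:: 0; 0; 0; 0; 1; 0; 0; 0]; [:: 0; 0; 0; 1; 2; 0; 0; 0];
        [:: 0; 0; 0; 1; 2; 0; 0; 0]; [:: 4; 4; 1; 1; 1; 0; 0; 0];
        [:: 0; 0; 0; 0; 0; 1; 0; 0]; [:: 0; 0; 0; 0; 0; 0; 1; 0];
        [:: 0; 0; 0; 0; 0; 1; 2; 0]; [:: 0; 0; 0; 0; 0; 1; 2; 0];
        [:: 4; 4; 1; 0; 0; 1; 1; 0]; [:: 0; 0; 0; 0; 0; 0; 0; 1]]);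
    vm_compute.
by apply: (@gamma_coded_ge _ _
  [:: (10, 13); (14, 11); (15, 14); (4, 15); (5, 9); (7, 8); (0, 4); (2, 3)]);
    vm_compute.
Qed.

Definition NYY_edges : seq (nat * nat) :=
  [:: (0, 2); (0, 3); (1, 2); (1, 3); (2, 3); (4, 6); (4, 7); (5, 6); (5, 7);
   (6, 7); (0, 4); (1, 5)].

(** Adjacency matrix plus identity: the two rows of a central pair coincide,
    and identifying them leaves the same matrix for the 6-cycle, whose kernel
    has dimension 2. *)
Lemma gamma_NYY : gamma_gr (coded 8 NYY_edges) = 4.
Proof.
apply/eqP; rewrite eqn_leq; apply/andP; split.
  by apply: (@gamma_coded_le _ _ _
    [:: [:: 1; 0; 1; 1]; [:: 0; 1; 1; 0]; [:: 1; 1; 1; 0]; [:: 1; 1; 1; 0];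
        [:: 1; 0; 0; 1]; [:: 0; 1; 0; 0]; [:: 0; 0; 0; 1]; [:: 0; 0; 0; 1]]
    [:: [:: 1; 0; 0; 0]; [:: 0; 1; 0; 0]; [:: 0; 0; 1; 0]; [:: 0; 0; 1; 0];
        [:: 0; 0; 0; 1]; [:: 4; 1; 0; 1]; [:: 0; 1; 4; 1]; [:: 0; 1; 4; 1]]);
    vm_compute.
by apply: (@gamma_coded_ge _ _
  [:: (4, 7); (1, 5); (0, 4); (2, 3)]); vm_compute.
Qed.

Definition prism_edges : seq (nat * nat) :=
  [:: (0, 1); (1, 2); (2, 0); (3, 4); (4, 5); (5, 3); (0, 3); (1, 4); (2, 5)].

(** The blocks X, I; I, -X, where -X is the inverse of X = 3I - 2J. *)
Lemma gamma_prism : gamma_gr (coded 6 prism_edges) = 3.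
Proof.
apply/eqP; rewrite eqn_leq; apply/andP; split.
  by apply: (@gamma_coded_le _ _ _
    [:: [:: 1; 3; 3]; [:: 3; 1; 3]; [:: 3; 3; 1]; [:: 1; 0; 0]; [:: 0; 1; 0];
        [:: 0; 0; 1]]
    [:: [:: 1; 0; 0]; [:: 0; 1; 0]; [:: 0; 0; 1]; [:: 4; 2; 2]; [:: 2; 4; 2];
        [:: 2; 2; 4]]);
    vm_compute.
by apply: (@gamma_coded_ge _ _
  [:: (2, 5); (1, 4); (0, 3)]); vm_compute.
Qed.

Definition Q3_edges : seq (nat * nat) :=
  [:: (0, 1); (1, 2); (2, 3); (3, 0); (4, 5); (5, 6); (6, 7); (7, 4); (0, 4);
   (1, 5); (2, 6); (3, 7)].

(** A signed adjacency matrix S of the 4-cycle satisfies S^2 = 2I, so S - I is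
    the inverse of S + I and the blocks S + I, I; I, S - I have rank 4. *)
Lemma gamma_Q3 : gamma_gr (coded 8 Q3_edges) = 4.
Proof.
apply/eqP; rewrite eqn_leq; apply/andP; split.
  by apply: (@gamma_coded_le _ _ _
    [:: [:: 1; 1; 0; 1]; [:: 1; 1; 1; 0]; [:: 0; 1; 1; 4]; [:: 1; 0; 4; 1];
        [:: 1; 0; 0; 0]; [:: 0; 1; 0; 0]; [:: 0; 0; 1; 0]; [:: 0; 0; 0; 1]]
    [:: [:: 1; 0; 0; 0]; [:: 0; 1; 0; 0]; [:: 0; 0; 1; 0]; [:: 0; 0; 0; 1];
        [:: 4; 1; 0; 1]; [:: 1; 4; 1; 0]; [:: 0; 1; 4; 4]; [:: 1; 0; 4; 4]]);
    vm_compute.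
by apply: (@gamma_coded_ge _ _
  [:: (3, 7); (2, 6); (1, 5); (0, 4)]); vm_compute.
Qed.

Definition TQ3_edges : seq (nat * nat) :=
  [:: (0, 1); (1, 2); (2, 3); (3, 0); (4, 5); (5, 6); (6, 7); (7, 4); (0, 4);
   (1, 5); (2, 7); (3, 6)].

(** The blocks P, I; I, Q up to a permutation of the outer cycle, where P has
    the nonzero entries of one 4-cycle and its inverse Q those of the 4-cycle
    twisted by exchanging two consecutive vertices. *)
Lemma gamma_TQ3 : gamma_gr (coded 8 TQ3_edges) = 4.
Proof.
apply/eqP; rewrite eqn_leq; apply/andP; split.
  by apply: (@gamma_coded_le _ _ _
    [:: [:: 1; 3; 0; 1]; [:: 1; 2; 1; 0]; [:: 0; 2; 2; 1]; [:: 4; 0; 1; 3];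
        [:: 1; 0; 0; 0]; [:: 0; 1; 0; 0]; [:: 0; 0; 0; 1]; [:: 0; 0; 1; 0]]
    [:: [:: 1; 0; 0; 0]; [:: 0; 1; 0; 0]; [:: 0; 0; 1; 0]; [:: 0; 0; 0; 1];
        [:: 2; 3; 2; 0]; [:: 4; 1; 0; 3]; [:: 0; 4; 2; 3]; [:: 3; 0; 2; 2]]);
    vm_compute.
by apply: (@gamma_coded_ge _ _
  [:: (2, 7); (3, 6); (1, 5); (0, 4)]); vm_compute.
Qed.

Definition petersen_edges : seq (nat * nat) :=
  [:: (0, 1); (1, 2); (2, 3); (3, 4); (4, 0); (0, 5); (1, 6); (2, 7); (3, 8);
   (4, 9); (5, 7); (6, 8); (7, 9); (8, 5); (9, 6)].

(** Adjacency matrix minus identity: 1 is an eigenvalue of the Petersen graph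
    of multiplicity 5. *)
Lemma gamma_petersen : gamma_gr (coded 10 petersen_edges) = 5.
Proof.
apply/eqP; rewrite eqn_leq; apply/andP; split.
  by apply: (@gamma_coded_le _ _ _
    [:: [:: 4; 1; 0; 0; 1]; [:: 1; 4; 1; 0; 0]; [:: 0; 1; 4; 1; 0];
        [:: 0; 0; 1; 4; 1]; [:: 1; 0; 0; 1; 4]; [:: 1; 0; 0; 0; 0];
        [:: 0; 1; 0; 0; 0]; [:: 0; 0; 1; 0; 0]; [:: 0; 0; 0; 1; 0];
        [:: 0; 0; 0; 0; 1]]
    [:: [:: 1; 0; 0; 0; 0]; [:: 0; 1; 0; 0; 0]; [:: 0; 0; 1; 0; 0];
        [:: 0; 0; 0; 1; 0]; [:: 0; 0; 0; 0; 1]; [:: 4; 0; 1; 1; 0];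
        [:: 0; 4; 0; 1; 1]; [:: 1; 0; 4; 0; 1]; [:: 1; 1; 0; 4; 0];
        [:: 0; 1; 1; 0; 4]]);
    vm_compute.
by apply: (@gamma_coded_ge _ _
  [:: (4, 9); (3, 8); (2, 7); (1, 6); (0, 5)]); vm_compute.
Qed.
Local Notation ord_at n i := (@Ordinal n i isT).

Lemma iso_K33 : graph_iso (coded 6 K33_edges) (complete_bipartite 3 3).
Proof.
pose hs : seq (complete_bipartite 3 3) :=
  [:: inl (ord_at 3 0); inl (ord_at 3 1); inl (ord_at 3 2);
      inr (ord_at 3 0); inr (ord_at 3 1); inr (ord_at 3 2)].
apply: (@iso_coded (complete_bipartite 3 3) (inl (ord_at 3 0)) hs); try by [];
  by [rewrite card_sum !card_ord | vm_compute].
Qed.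

Definition Y_vertices : seq Y :=
  [:: inl (ord_at 2 0); inl (ord_at 2 1); inr (ord_at 3 0); inr (ord_at 3 1);
      alpha_Y].

Lemma iso_Y2 : graph_iso (coded 10 Y2_edges) Y2.
Proof.
pose hs : seq Y2 := map inl Y_vertices ++ map inr Y_vertices.
apply: (@iso_coded Y2 (inl alpha_Y) hs); try by [];
  by [rewrite !card_sum !card_ord | vm_compute].
Qed.

Lemma iso_Y3 : graph_iso (coded 16 Y3_edges) Y3.
Proof.
pose hs : seq Y3 :=
  [seq Some (i, y) | i <- [:: ord_at 3 0; ord_at 3 1; ord_at 3 2], y <- Y_vertices]
    ++ [:: None].
apply: (@iso_coded Y3 None hs); try by [];
  by [rewrite card_option card_prod card_sum !card_ord | vm_compute].
Qed.

Definition I4_enum : seq 'I_4 :=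
  [:: ord_at 4 0; ord_at 4 1; ord_at 4 2; ord_at 4 3].

Lemma iso_NYY : graph_iso (coded 8 NYY_edges) N_YY.
Proof.
pose hs : seq N_YY := map inl I4_enum ++ map inr I4_enum.
apply: (@iso_coded N_YY (inl (ord_at 4 0)) hs); try by [];
  by [rewrite card_sum !card_ord | vm_compute].
Qed.

Lemma iso_TQ3 : graph_iso (coded 8 TQ3_edges) TQ3.
Proof.
pose hs : seq TQ3 := map inl I4_enum ++ map inr I4_enum.
apply: (@iso_coded TQ3 (inl (ord_at 4 0)) hs); try by [];
  by [rewrite card_sum !card_ord | vm_compute].
Qed.

Lemma iso_prism : graph_iso (coded 6 prism_edges) prism.
Proof.
pose hs : seq prism := 
  [:: (ord_at 3 0, ord_at 2 0); (ord_at 3 1, ord_at 2 0); (ord_at 3 2, ord_at 2 0);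
      (ord_at 3 0, ord_at 2 1); (ord_at 3 1, ord_at 2 1); (ord_at 3 2, ord_at 2 1)].
apply: (@iso_coded prism (ord_at 3 0, ord_at 2 0) hs); try by [];
  by [rewrite card_prod !card_ord | vm_compute].
Qed.

Lemma iso_Q3 : graph_iso (coded 8 Q3_edges) Q3.
Proof.
pose c4 := [:: (ord_at 2 0, ord_at 2 0); (ord_at 2 0, ord_at 2 1);
               (ord_at 2 1, ord_at 2 1); (ord_at 2 1, ord_at 2 0)].
pose hs : seq Q3 :=
  [seq (x, ord_at 2 0) | x <- c4] ++ [seq (x, ord_at 2 1) | x <- c4].
apply: (@iso_coded Q3 ((ord_at 2 0, ord_at 2 0), ord_at 2 0) hs); try by [];
  by [rewrite !card_prod !card_ord | vm_compute].
Qed.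

Definition petersen_pairs : seq ('I_5 * 'I_5) :=
  [:: (ord_at 5 0, ord_at 5 1); (ord_at 5 2, ord_at 5 3);
      (ord_at 5 4, ord_at 5 0); (ord_at 5 1, ord_at 5 2);
      (ord_at 5 3, ord_at 5 4); (ord_at 5 2, ord_at 5 4);
      (ord_at 5 1, ord_at 5 4); (ord_at 5 1, ord_at 5 3);
      (ord_at 5 0, ord_at 5 3); (ord_at 5 0, ord_at 5 2)].

Lemma iso_petersen : graph_iso (coded 10 petersen_edges) petersen.
Proof.
pose pr (i : nat) := nth (ord_at 5 0, ord_at 5 1) petersen_pairs i.
have neq i : (pr i).1 != (pr i).2.
  by do 10?[case: i => [//|i]]; rewrite /pr nth_default.
have card2 i : #|[set (pr i).1; (pr i).2]| == 2 by rewrite cards2 neq.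
pose f (i : coded 10 petersen_edges) : petersen :=
  exist (fun A : {set 'I_5} => #|A| == 2) _ (card2 (val i)).
have fE i j : edge (f i) (f j) = listed petersen_edges i j.
  pose dj (p q : 'I_5 * 'I_5) :=
    [&& p.1 != q.1, p.1 != q.2, p.2 != q.1 & p.2 != q.2].
  have dE (k l : coded 10 petersen_edges) :
    [disjoint val (f k) & val (f l)] = dj (pr k) (pr l).
    rewrite /= disjoints_subset subUset !sub1set !inE !negb_or /dj.
    by rewrite -!andbA.
  have dj_neq (k l : coded 10 petersen_edges) : dj (pr k) (pr l) -> f k != f l.
    rewrite -dE; apply: contraTneq => ->; rewrite -setI_eq0 setIid.
    by apply/set0Pn; exists (pr l).1; rewrite !inE eqxx.
  have -> : edge (f i) (f j) = dj (pr i) (pr j) || dj (pr j) (pr i).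
    change ((f i != f j) && ([disjoint val (f i) & val (f j)]
      || [disjoint val (f j) & val (f i)]) = dj (pr i) (pr j) || dj (pr j) (pr i)).
    rewrite !dE; case: (boolP (_ || _)) => [|_]; last by rewrite andbF.
    by case/orP=> /dj_neq; rewrite // eq_sym => ->.
  apply/eqP; apply: (@all_pairsP 10 (fun i j =>
    dj (pr i) (pr j) || dj (pr j) (pr i) == listed petersen_edges i j));
    by [vm_compute | exact: ltn_ord].
exists f; split; last by move=> x y; rewrite fE.
apply: inj_card_bij; last first.
  have := card_draws 'I_5 2; rewrite cardsE !card_ord => card_pairs.
  by rewrite card_sig card_pairs.
(* No two vertices of the Petersen graph have the same neighbours. *)
move=> i j eij.
have rows : all_pairs 10 (fun i j => (i == j) || has (fun k =>
  listed petersen_edges i k != listed petersen_edges j k) (iota 0 10)).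
  by vm_compute.
have /orP[/eqP/val_inj //|] := all_pairsP rows (ltn_ord i) (ltn_ord j).
case/hasP=> k; rewrite mem_iota => kP.
by have:= fE i (Ordinal kP); rewrite eij fE /= => ->; rewrite eqxx.
Qed.

(** * Neighbours in a cubic graph *)

Definition nbrs (G : sgraph) (v x y z : G) : Prop :=
  uniq [:: x; y; z] /\ forall w, edge v w = (w \in [:: x; y; z]).

Section Cubic.
Variable G : sgraph.
Hypothesis cubG : cubic G.
Implicit Types (v w x y z : G).

Lemma nbrs_perm v x y z x' y' z' :
  perm_eq [:: x; y; z] [:: x'; y'; z'] -> nbrs v x y z -> nbrs v x' y' z'.
Proof.
move=> pe [u e]; split; first by rewrite -(perm_uniq pe).
by move=> w; rewrite e (perm_mem pe).
Qed.

Lemma nbrs_swap v x y z : nbrs v x y z -> nbrs v y x z.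
Proof. by apply: nbrs_perm; rewrite (perm_catCA [:: x] [:: y] [:: z]). Qed.

Lemma nbrs_rot v x y z : nbrs v x y z -> nbrs v y z x.
Proof. by apply: nbrs_perm; rewrite (perm_catC [:: x] [:: y; z]). Qed.

Lemma nbrs_edge v x y z : nbrs v x y z ->
  [/\ edge v x, edge v y & edge v z] /\ [/\ edge x v, edge y v & edge z v].
Proof. by case=> _ e; rewrite ![edge _ v]edge_sym !e !inE !eqxx !orbT. Qed.

Lemma nbrs_neq v x y z : nbrs v x y z -> [/\ x != y, x != z & y != z].
Proof.
by case; rewrite /= !inE negb_or andbT => /andP[/andP[-> ->] ->].
Qed.

Lemma nbrs_ex v : exists x y z, nbrs v x y z.
Proof.
have := cubG v; rewrite /degree cardE.
case E: (enum _) => [|x [|y [|z [|? ?]]]] // _; exists x, y, z.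
split; first by rewrite -E enum_uniq.
by move=> w; rewrite -E mem_enum inE.
Qed.

Lemma nbrs_ex1 v x : edge v x -> exists y z, nbrs v x y z.
Proof.
have [a [b [c n]]] := nbrs_ex v; have [_ e] := n; rewrite e !inE.
case/or3P=> /eqP->; [exists b, c | exists a, c | exists a, b] => //.
  exact: nbrs_swap.
by do 2!apply: nbrs_rot.
Qed.

Lemma nbrs_ex2 v x y : x != y -> edge v x -> edge v y ->
  exists z, nbrs v x y z.
Proof.
move=> xy /nbrs_ex1[b [c n]]; have [_ ->] := n; rewrite !inE eq_sym (negPf xy) /=.
case/orP=> /eqP->; [by exists c | exists b].
exact/nbrs_swap/nbrs_rot/nbrs_rot.
Qed.

Lemma nbhdE v x y z : nbrs v x y z -> closed_nbhd v = [set v; x; y; z].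
Proof. by case=> _ e; apply/setP => w; rewrite in_nbhd e !inE -!orbA. Qed.

Lemma card_nbhd v : #|closed_nbhd v| = 4.
Proof.
rewrite -[4]/(1 + 3) -(cubG v) /degree -(cards1 v) -cardsUI.
have -> : [set v] :&: [set y | edge v y] = set0.
  by apply/setP=> w; rewrite !inE; case: eqP => // ->; rewrite edge_irrefl.
rewrite cards0 addn0; congr #|pred_of_set _|; apply/setP=> w.
by rewrite !inE.
Qed.

End Cubic.

(** * Legal sequences in a connected cubic graph *)

Section Potential.
Variable G : sgraph.
Hypotheses (connG : connected G) (cubG : cubic G).
Implicit Types (u v w x y z : G) (s : seq G) (D C : {set G}).

Lemma connected_closed C x : x \in C ->
  (forall v w, v \in C -> edge v w -> w \in C) -> C = setT.
Proof.
move=> xC closedC; apply/setP=> y; rewrite inE -xC; apply/esym.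
apply: (closed_connect _ (connG.2 x y)).
by apply: (intro_closed (sym_connect_sym (@edge_sym G))) => v w vw vC;
  apply: closedC vw.
Qed.

Lemma boundary D x : x \in D -> D != setT ->
  exists v w, [/\ v \in D, w \notin D & edge v w].
Proof.
move=> xD DT; case: (boolP [exists v in D, [exists w, edge v w && (w \notin D)]]).
  by case/existsP=> v /andP[vD /existsP[w /andP[vw wD]]]; exists v, w.
move=> H; case/eqP: DT; apply: connected_closed xD _ => v w vD vw.
apply: contraNT H => wD; apply/existsP; exists v; rewrite vD.
by apply/existsP; exists w; rewrite vw.
Qed.

(** A dominated vertex has a dominated neighbour besides itself, unless it is
    itself a term, and then it gains nothing. *)
Lemma card_new x s : x \in dominated s -> #|closed_nbhd x :\: dominated s| <= 2.
Proof.
rewrite in_dominated => /hasP[v vs xv].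
have vD w : w \in closed_nbhd v -> w \in dominated s.
  by move=> wv; rewrite in_dominated; apply/hasP; exists v.
have vx : v \in closed_nbhd x.
  by move: xv; rewrite !in_nbhd eq_sym edge_sym.
case: (eqVneq x v) => [->|xneqv].
  by rewrite (_ : _ :\: _ = set0) ?cards0 //; apply/eqP; rewrite setD_eq0;
     apply/subsetP.
rewrite cardsD (card_nbhd cubG) leq_subLR -(addn2 2) leq_add2r.
have <- : #|[set x; v]| = 2 by rewrite cards2 xneqv.
apply: subset_leq_card; apply/subsetP=> w.
by rewrite in_set2 inE => /orP[]/eqP->; rewrite ?vx ?nbhd_refl vD ?nbhd_refl.
Qed.

(** While some vertex is undominated, connectedness provides a dominated vertex
    next to it; appending that vertex gains one or two vertices. *)
Lemma extend s : legal s -> 0 < size s ->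
  exists s', [/\ legal s', dominated s' = setT &
                 2 * size s + #|G| <= 2 * size s' + #|dominated s| ].
Proof.
have [n] := ubnP #|~: dominated s|; elim: n s => // n IH s sn ls s0.
have [DT|DT] := eqVneq (dominated s) setT.
  by exists s; rewrite ls DT cardsT.
have [z zD] : exists z, z \in dominated s.
  case: s s0 {sn ls DT IH} => // z s _; exists z.
  by rewrite dominated_cons inE nbhd_refl.
have [x [y [xD yD xy]]] := boundary zD DT.
have yx : y \in closed_nbhd x by rewrite in_nbhd xy orbT.
have lxs : legal (x :: s) by rewrite /= ls andbT; apply/subsetPn; exists y.
have cD : #|dominated (x :: s)| <= #|dominated s| + 2.
  rewrite dominated_cons cardsU addnC -addnBA ?subset_leq_card ?subsetIl //.
  by rewrite leq_add2l -cardsD card_new.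
have [|s' [ls' Ds' ps']] := IH (x :: s) _ lxs isT.
  rewrite -ltnS; apply: leq_trans sn; rewrite ltnS; apply: proper_card.
  rewrite properC; apply/properP; split; first by rewrite dominated_cons subsetUr.
  by exists y; rewrite // dominated_cons inE yx.
exists s'; split=> //; rewrite -(leq_add2r 2) addnAC -[X in _ <= X]addnA.
apply: leq_trans (leq_trans ps' _); first by rewrite /= mulnSr.
by rewrite leq_add2l.
Qed.

End Potential.

(** * Tight sets *)

Lemma nbrs_intro (G : sgraph) (v x y z : G) : cubic G ->
  uniq [:: x; y; z] -> edge v x -> edge v y -> edge v z -> nbrs v x y z.
Proof.
move=> cubG u vx vy vz; have := u; rewrite /= !inE negb_or andbT.
case/andP=> /andP[xy xz] yz; have [t n] := nbrs_ex2 cubG xy vx vy.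
have := vz; have [_ e] := n; rewrite e !inE eq_sym (negPf xz) eq_sym (negPf yz).
by move/eqP->.
Qed.

Section Tight.
Variable G : sgraph.
Hypotheses (connG : connected G) (cubG : cubic G).
Hypothesis tightG : 2 * gamma_gr G = #|G|.
Implicit Types (u v w x y z : G) (s : seq G) (D C : {set G}).

(** Otherwise the extension that dominates everything would be too long. *)
Lemma legal_le s : legal s -> 2 * size s <= #|dominated s|.
Proof.
case: s => [//|x s] ls; have [//|s' [ls' _]] := extend connG cubG ls.
have s'G : 2 * size s' <= #|G| by rewrite -tightG leq_mul2l legal_gamma.
move=> ps; rewrite -(leq_add2r #|G|) (leq_trans ps) //.
by rewrite addnC leq_add2l.
Qed.

Definition tight D : Prop :=
  exists s, [/\ legal s, dominated s = D & 2 * size s = #|D|].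

(** Gaining exactly one vertex over a tight set would contradict
    [legal_le]. *)
Lemma tight_step D x w : tight D -> w \in closed_nbhd x -> w \notin D ->
  exists w', [/\ w' \in closed_nbhd x, w' \notin D & w' != w].
Proof.
case=> s [ls <- ps] wx wD.
have lxs : legal (x :: s) by rewrite /= ls andbT; apply/subsetPn; exists w.
have := legal_le lxs; rewrite dominated_cons /= mulnSr ps.
case: (boolP [exists v, [&& v \in closed_nbhd x, v \notin dominated s & v != w]]).
  by case/existsP=> v /and3P[]; exists v.
move=> H; suff -> : closed_nbhd x :|: dominated s = w |: dominated s.
  by rewrite cardsU1 wD addnC leq_add2r.
apply/setP=> v; rewrite in_setU in_setU1; case: (boolP (v \in dominated s)).
  by rewrite !orbT.
move=> vD; rewrite !orbF; apply/idP/eqP => [vx|->//]; apply/eqP.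
by apply: contraNT H => vw; apply/existsP; exists v; rewrite vx vD.
Qed.

(** Gaining exactly two vertices keeps the balance; a vertex of [D] never gains
    three. *)
Lemma tight_pair D x a b c : tight D -> x \in D -> nbrs x a b c ->
  a \notin D -> b \notin D -> c \in D /\ tight (a |: (b |: D)).
Proof.
case=> s [ls sD ps] xD n aD bD; have [ab _ _] := nbrs_neq n.
have new : [set a; b] = closed_nbhd x :\: dominated s.
  apply/eqP; rewrite eqEcard cards2 ab card_new ?sD // andbT.
  apply/subsetP=> w; rewrite (nbhdE n) !inE => /orP[]/eqP->;
  by rewrite ?aD ?bD ?eqxx ?orbT.
have cD : c \in D.
  have [_ ac bc] := nbrs_neq n; have : c \notin [set a; b].
    by rewrite !inE negb_or !(eq_sym c) ac bc.
  by rewrite new sD (nbhdE n) !inE eqxx !orbT andbT negbK.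
split=> //; exists (x :: s); split.
- rewrite /= ls andbT sD; apply/subsetPn; exists a => //.
  by rewrite (nbhdE n) !inE eqxx !orbT.
- apply/setP=> w; rewrite dominated_cons -sD setUA new.
  by rewrite !inE; case: (w \in dominated s); rewrite ?orbT ?andbF.
rewrite /= mulnSr ps !cardsU1 !inE negb_or ab aD bD.
by rewrite addnCA addnC addnA.
Qed.

(** The usual way to exhibit a tight set: the legal sequence dominates at least
    twice its length, so a list of twice its length which contains all that is
    dominated contains nothing else and has no repetition. *)
Lemma tight_list (f : seq (G * G)) (l : seq G) :
  footprinted f -> (forall a, a \in f -> {subset closed_nbhd a.1 <= l}) ->
  size l <= 2 * size f -> tight [set x in l] /\ uniq l.
Proof.
move=> /footprinted_legal lf sub sl.
have ps := legal_le lf; rewrite size_map in ps.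
have Dl : dominated (unzip1 f) \subset [set x in l].
  apply/subsetP=> y; rewrite in_dominated inE => /hasP[_ /mapP[a af ->]].
  exact: sub.
have cl : #|[set x in l]| <= size l by rewrite cardsE card_size.
have c1 := subset_leq_card Dl.
have e : #|[set x in l]| = size l.
  apply/eqP; rewrite eqn_leq cl /=.
  exact: leq_trans sl (leq_trans ps c1).
split; last by apply/card_uniqP; rewrite -e cardsE.
exists (unzip1 f); split=> //.
  by apply/eqP; rewrite eqEcard Dl e (leq_trans sl ps).
by rewrite size_map; apply/eqP; rewrite eqn_leq (leq_trans ps c1) e sl.
Qed.

(** Suppose first that [u1] and [u2] are adjacent.  A third neighbour [z] of
    [u1] outside [D] would be the only gain of [u1] after [x]; so [z] is in [D]
    and has a second new neighbour, which must be [u2], since otherwise [x]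
    would gain only [u2] after [z].  Suppose now that they are not adjacent and
    that [u1] has two neighbours in [D].  Since [u1] cannot gain just itself,
    its third neighbour is new, and is its only gain after [x]. *)
Lemma star D x u1 u2 w : tight D -> x \in D -> nbrs x u1 u2 w ->
  u1 \notin D -> u2 \notin D ->
  (exists z, [/\ z \in D, nbrs u1 x u2 z & nbrs u2 x u1 z]) \/
  (~~ edge u1 u2 /\
   forall u v, u \in [:: u1; u2] -> edge u v -> v != x -> v \notin D).
Proof.
move=> tD xD n u1D u2D; have [wD tD'] := tight_pair tD xD n u1D u2D.
have [[xu1 xu2 xw] [u1x u2x wx]] := nbrs_edge n; have [u12 _ _] := nbrs_neq n.
case: (boolP (edge u1 u2)) => [e12|ne12]; last first.
  have side a b : nbrs x a b w -> a \notin D -> b \notin D -> ~~ edge a b ->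
    forall v, edge a v -> v != x -> v \notin D.
    move=> n' aD bD nab v av vx; apply/negP => vD.
    have ax : edge a x by have [_ []] := nbrs_edge n'.
    rewrite eq_sym in vx; have [t nt] := nbrs_ex2 cubG vx ax av.
    have at_ : edge a t by have [[]] := nbrs_edge nt.
    have [t' []] := tight_step tD (nbhd_refl a) aD.
    rewrite (nbhdE nt) !inE -!orbA => /or4P[]/eqP->; rewrite ?eqxx ?xD ?vD //.
    move=> tD0 ta; have [_ tD2] := tight_pair tD xD n' aD bD.
    have tD3 : t \notin a |: (b |: D).
      rewrite !inE !negb_or tD0 ta andbT; apply: contraNneq nab => <-.
      exact: at_.
    have [|t2 []] := tight_step (x := a) tD2 _ tD3.
      by rewrite (nbhdE nt) !inE eqxx !orbT.
    rewrite (nbhdE nt) !inE -!orbA => /or4P[]/eqP->;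
      by rewrite ?eqxx ?xD ?vD ?orbT.
  right; split=> // u v; rewrite !inE => /orP[]/eqP->; first exact: side n _ _ _ v.
  by apply: side (nbrs_swap n) _ _ _ v; rewrite // edge_sym.
left; have xu2' := edge_neq xu2.
have [z nz] := nbrs_ex2 cubG xu2' u1x e12.
have [_ xz u2z] := nbrs_neq nz; have [[_ _ u1z] _] := nbrs_edge nz.
have zu1 := edge_neq u1z; rewrite eq_sym in zu1.
have zD : z \in D.
  apply/negPn/negP => zD; have zD' : z \notin u1 |: (u2 |: D).
    by rewrite !inE !negb_or zD zu1 eq_sym u2z.
  have [|t []] := tight_step (x := u1) tD' _ zD'.
    by rewrite (nbhdE nz) !inE eqxx !orbT.
  rewrite (nbhdE nz) !inE -!orbA => /or4P[]/eqP->;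
      by rewrite ?eqxx ?xD ?orbT.
exists z; split=> //.
have zu : edge z u1 by rewrite edge_sym.
have [|t []] := tight_step (x := z) tD _ u1D.
  by rewrite in_nbhd zu orbT.
rewrite in_nbhd => /orP[/eqP->|zt]; first by rewrite zD.
move=> tD0 tu1; case: (eqVneq t u2) => [tu2|tu2].
  apply: nbrs_intro; rewrite // 1?edge_sym ?e12 -?tu2 //.
  by rewrite /= !inE negb_or xz (edge_neq u1z) (edge_neq xu1).
rewrite eq_sym in tu1; have [c nc] := nbrs_ex2 cubG tu1 zu zt.
have [_ tD2] := tight_pair tD zD nc u1D tD0.
have [||t2 []] := tight_step (x := x) (w := u2) tD2.
- by rewrite in_nbhd xu2 orbT.
- by rewrite !inE !negb_or eq_sym u12 eq_sym tu2.
rewrite (nbhdE n) !inE -!orbA => /or4P[]/eqP->;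
      by rewrite ?eqxx ?xD ?wD ?orbT.
Qed.

End Tight.

(** * Branches *)

(** A copy of Y, where [p] and [q] are the ends of the diamond, [r] and [s] its
    central pair, and [be] is the neighbour of [al] outside the copy. *)
Definition Y_at (G : sgraph) (al be p q r s : G) : Prop :=
  [/\ nbrs al be p q, nbrs p al r s, nbrs q al r s, nbrs r s p q
    & nbrs s r p q].

Section Branches.
Variable G : sgraph.
Hypotheses (connG : connected G) (cubG : cubic G).
Hypothesis tightG : 2 * gamma_gr G = #|G|.
Implicit Types (u v w x y z : G) (D C : {set G}).

(** After [x], the vertex [u1] is in turn a vertex of a tight set with two new
    neighbours, to which [star] applies.  If these are the central pair of a
    diamond, its other end is [u2]: were it in [D], then [star] at that end
    would contradict that [u1] is new. *)
Lemma fork D x u1 u2 w : tight D -> x \in D -> nbrs x u1 u2 w ->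
  u1 \notin D -> u2 \notin D -> ~~ edge u1 u2 ->
  let D' := u1 |: (u2 |: D) in
  exists y z, [/\ nbrs u1 y z x, y \notin D', z \notin D' &
    ~~ edge y z \/ [/\ nbrs u2 y z x, nbrs y z u1 u2 & nbrs z y u1 u2]].
Proof.
move=> tD xD n u1D u2D ne /=.
have [_ tD'] := tight_pair cubG tD xD n u1D u2D.
have [[_ _ _] [u1x u2x _]] := nbrs_edge n; have [u12 _ _] := nbrs_neq n.
have [[t [_ n1 _]]|[_ S]] := star connG cubG tightG tD xD n u1D u2D.
  by case/negP: ne; have [[]] := nbrs_edge n1.
have [y [z nx]] := nbrs_ex1 cubG u1x; have nu := nbrs_rot nx.
have [xy xz yz] := nbrs_neq nx.
have [[u1y u1z _] [yu1 zu1 _]] := nbrs_edge nu.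
have out v : edge u1 v -> x != v -> v \notin u1 |: (u2 |: D).
  move=> u1v xv; rewrite !inE !negb_or [v == u1]eq_sym (edge_neq u1v) /=.
  rewrite (S u1 v) ?inE ?eqxx 1?[v == x]eq_sym // andbT.
  by apply: contraNneq ne => <-.
have yD' := out y u1y xy; have zD' := out z u1z xz.
exists y, z; split=> //.
have u1D' : u1 \in u1 |: (u2 |: D) by rewrite !inE eqxx.
have [[t [tD0 ny nz]]|[nyz _]] := star connG cubG tightG tD' u1D' nu yD' zD';
  [right | by left].
have [_ u1t zt] := nbrs_neq ny; have [_ _ yt] := nbrs_neq nz.
have [[_ eyz eyt] [_ ezy ety]] := nbrs_edge ny.
have [_ [_ _ etz]] := nbrs_edge nz.
have [yD zD] : y \notin D /\ z \notin D.
  by move: yD' zD'; rewrite !inE !negb_or => /and3P[_ _ ->] /and3P[_ _ ->].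
have e2 : u2 = t.
  move: tD0; rewrite !inE eq_sym (negPf u1t) /= => /orP[/eqP //|tD0].
  have [c nt] := nbrs_ex2 cubG yz ety etz.
  case: (star connG cubG tightG tD tD0 nt yD zD) => [[c' [c'D n1 _]]|[]].
    have := yu1; have [_ ->] := n1; rewrite !inE => /or3P[]/eqP e.
    - by move: u1D; rewrite e tD0.
    - by move: u1z; rewrite e edge_irrefl.
    by move: u1D; rewrite e c'D.
  by rewrite eyz.
rewrite -e2 in ety etz ny nz; split.
- by apply: nbrs_intro => //; case: nu.
- exact: nbrs_swap ny.
exact: nbrs_swap nz.
Qed.

Lemma card_setC_step D u v : u \notin D -> #|~: (u |: (v |: D))| < #|~: D|.
Proof.
move=> uD; apply: proper_card; rewrite properC; apply/properP; split.
  by rewrite setUA subsetUr.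
by exists u; rewrite // !inE eqxx.
Qed.

(** The part of the complement that is reached from [x] meets [D] only in [x]:
    by [fork] the arms at [u1] and [u2] either close up or are branches of the
    same kind for a larger tight set. *)
Lemma branch_closed D x u1 u2 w : tight D -> x \in D -> nbrs x u1 u2 w ->
  u1 \notin D -> u2 \notin D -> ~~ edge u1 u2 ->
  exists C, [/\ [disjoint C & D], u1 \in C, u2 \in C &
    forall v v', v \in C -> edge v v' -> v' \in C \/ v' = x].
Proof.
have [n] := ubnP #|~: D|; elim: n D x u1 u2 w => // n IH D x u1 u2 w Dn.
move=> tD xD nx u1D u2D ne.
have Dn' u v : u \notin D -> #|~: (u |: (v |: D))| < n.
  by move=> uD; apply: leq_trans (card_setC_step v uD) _.
have leaf y z : nbrs u1 y z x -> nbrs u2 y z x -> nbrs y z u1 u2 ->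
    nbrs z y u1 u2 -> y \notin D -> z \notin D ->
    exists C, [/\ [disjoint C & D], u1 \in C, u2 \in C &
    forall v v', v \in C -> edge v v' -> v' \in C \/ v' = x].
  move=> [_ n1] [_ n2] [_ ny] [_ nz] yD zD; exists [set u1; u2; y; z].
  split; try by rewrite !inE eqxx ?orbT.
    by rewrite disjoints_subset !subUset !sub1set !inE u1D u2D yD zD.
  move=> v v'; rewrite !inE -!orbA => /or4P[]/eqP->;
    rewrite ?n1 ?n2 ?ny ?nz !inE => /or3P[]/eqP->; rewrite ?eqxx ?orbT;
    by [left | right].
have [_ tD'] := tight_pair cubG tD xD nx u1D u2D.
have [y [z [n1 yD zD [nyz|[n2 ny nz]]]]] := fork tD xD nx u1D u2D ne; last first.
  move: yD zD; rewrite !inE !negb_or => /and3P[_ _ yD] /and3P[_ _ zD].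
  exact: (leaf y z).
have ne' : ~~ edge u2 u1 by rewrite edge_sym.
have [y' [z' [n2 yD' zD' [nyz'|[n1' ny nz]]]]] :=
  fork tD xD (nbrs_swap nx) u2D u1D ne'; last first.
  move: yD' zD'; rewrite !inE !negb_or => /and3P[_ _ yD'] /and3P[_ _ zD'].
  by apply: (leaf y' z'); rewrite //; apply/nbrs_rot/nbrs_swap.
rewrite setUCA in yD' zD'.
have [|C1 [d1 yC zC cl1]] := IH _ u1 y z x (Dn' u1 u2 u1D) tD' _ n1 yD zD nyz.
  by rewrite !inE eqxx.
have [|C2 [d2 yC' zC' cl2]] :=
    IH _ u2 y' z' x (Dn' u1 u2 u1D) tD' _ n2 yD' zD' nyz'.
  by rewrite !inE eqxx orbT.
have sub : D \subset u1 |: (u2 |: D) by rewrite setUA subsetUr.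
exists (u1 |: (u2 |: (C1 :|: C2))); split; try by rewrite !inE eqxx ?orbT.
  rewrite disjoints_subset !subUset !sub1set !inE u1D u2D /= -!disjoints_subset.
  by rewrite (disjointWr sub d1) (disjointWr sub d2).
move=> v v'; rewrite !inE => /or4P[/eqP->|/eqP->|vC|vC].
- have [_ ->] := n1; rewrite !inE => /or3P[]/eqP->; last by right.
    by rewrite yC !orbT; left.
  by rewrite zC !orbT; left.
- have [_ ->] := n2; rewrite !inE => /or3P[]/eqP->; last by right.
    by rewrite yC' !orbT; left.
  by rewrite zC' !orbT; left.
- by case/(cl1 _ _ vC) => ->; left; rewrite ?eqxx ?orbT.
by case/(cl2 _ _ vC) => ->; left; rewrite ?eqxx ?orbT.
Qed.

(** By [fork], following [u1] and then one arm after the other must end, and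
    the only way to end is a diamond that hangs at the vertex just passed. *)
Lemma branch_Y D x u1 u2 w : tight D -> x \in D -> nbrs x u1 u2 w ->
  u1 \notin D -> u2 \notin D -> ~~ edge u1 u2 ->
  exists al be p q r s, [/\ Y_at al be p q r s,
    [/\ p \notin D, q \notin D, r \notin D & s \notin D] &
    (al = x /\ be = w) \/ (al \notin D /\ (be \notin D \/ be = x))].
Proof.
have [n] := ubnP #|~: D|; elim: n D x u1 u2 w => // n IH D x u1 u2 w Dn.
move=> tD xD nx u1D u2D ne.
have [_ tD'] := tight_pair cubG tD xD nx u1D u2D.
have out v : v \notin u1 |: (u2 |: D) -> v \notin D.
  by rewrite !inE !negb_or => /and3P[].
have [y [z [n1 yD zD [nyz|[n2 ny nz]]]]] := fork tD xD nx u1D u2D ne; last first.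
  exists x, w, u1, u2, y, z; split; first split=> //.
  - exact/nbrs_rot/nbrs_rot.
  - exact/nbrs_rot/nbrs_rot.
  - exact/nbrs_rot/nbrs_rot.
  - by rewrite u1D u2D !out.
  by left.
have [||al [be [p [q [r [s [Y1 [pD qD rD sD] ab]]]]]]] :=
    IH _ u1 y z x _ tD' _ n1 yD zD nyz.
- exact: leq_trans (card_setC_step u2 u1D) _.
- by rewrite !inE eqxx.
exists al, be, p, q, r, s; split; first by [].
  by rewrite !out.
right; case: ab => [[-> ->]|[aD [bD|->]]]; first by split; [|right].
  by split; [|left]; apply: out.
by split; [apply: out | left].
Qed.

End Branches.

(** * Recognising a graph from a list of vertices *)

(** The adjacencies listed in [l] already exhaust the degrees, so they are all
    the adjacencies among [vs], and [vs] is closed under adjacency. *)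
Lemma iso_of_list (G : sgraph) n l (v0 : G) (vs : seq G) :
  connected G -> cubic G -> 0 < n ->
  all (fun i => count (listed l i) (iota 0 n) == 3) (iota 0 n) ->
  size vs = n -> uniq vs ->
  all (fun a => edge (nth v0 vs a.1) (nth v0 vs a.2)) l ->
  graph_iso G (coded n l).
Proof.
move=> connG cubG n_gt0 /allP cub3 sz us /allP el.
apply: graph_iso_sym; pose f i := nth v0 vs i.
have fE i j : listed l i j -> edge (f i) (f j).
  by case/andP=> _ /orP[/el //|/el]; rewrite edge_sym.
have nbE i w : i < n -> edge (f i) w -> exists2 j, j < n & w = f j /\ listed l i j.
  move=> ltin iw; pose ns := [seq j <- iota 0 n | listed l i j].
  have uns : uniq [seq f j | j <- ns].
    rewrite map_inj_in_uniq ?filter_uniq ?iota_uniq // => j k.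
    rewrite !mem_filter !mem_iota => /and3P[_ _ jn] /and3P[_ _ kn] /eqP.
    by rewrite /f nth_uniq ?sz // => /eqP.
  have sub : [set x in [seq f j | j <- ns]] \subset [set y | edge (f i) y].
    apply/subsetP=> y; rewrite !inE => /mapP[j].
    by rewrite mem_filter => /andP[ij _] ->; apply: fE.
  have /eqP eqn : [set x in [seq f j | j <- ns]] == [set y | edge (f i) y].
    rewrite eqEcard sub /= -/(degree (f i)) cubG cardsE (card_uniqP uns).
    by rewrite size_map size_filter (eqP (cub3 i _)) // mem_iota.
  have : w \in [set y | edge (f i) y] by rewrite inE.
  rewrite -eqn inE => /mapP[j]; rewrite mem_filter mem_iota => /and3P[ij _ jn] ->.
  by exists j.
have all_vs : [set x in vs] = setT.
  apply: (connected_closed connG (x := f 0)); first by rewrite inE mem_nth ?sz.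
  move=> v w; rewrite !inE => /(nthP v0)[i]; rewrite sz => ltin <-.
  by case/(nbE _ _ ltin) => j ltjn [-> _]; rewrite mem_nth ?sz.
have vsT w : w \in vs by have := in_setT w; rewrite -all_vs inE.
exists (fun i : coded n l => f (val i)); split.
  exists (fun w => Ordinal (eq_ind _ (fun m => index w vs < m)
     (etrans (index_mem w vs) (vsT w)) _ sz)) => [i|w].
    by apply: val_inj; rewrite /= index_uniq ?sz.
  by rewrite /f /= nth_index.
move=> i j; rewrite coded_edge; apply/idP/idP => [|/fE //].
case/(nbE _ _ (ltn_ord i)) => k kn [/eqP e ij].
by move: e; rewrite /f nth_uniq ?sz ?ltn_ord // => /eqP ->.
Qed.

Lemma footprinted_cat (G : sgraph) (f1 f2 : seq (G * G)) :
  footprinted f1 -> footprinted f2 ->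
  (forall a b, a \in f1 -> b \in f2 -> a.2 \notin closed_nbhd b.1) ->
  footprinted (f1 ++ f2).
Proof.
case/andP=> a1 p1 /andP[a2 p2] H; rewrite /footprinted all_cat a1 a2.
rewrite pairwise_cat p1 p2 !andbT; apply/allrelP => a b af bf.
by rewrite -in_nbhd H.
Qed.

(* Adds the disequalities implied by the known neighbourhoods. *)
Ltac nbrs_neqs :=
  repeat match goal with
  | H : nbrs ?v ?x ?y ?z |- _ =>
    lazymatch goal with
    | _ : is_true (v != x), _ : is_true (v != y), _ : is_true (v != z),
      _ : is_true (x != y), _ : is_true (x != z), _ : is_true (y != z) |- _
      => fail
    | _ => have [? ? ?] := nbrs_neq H;
      have [[/edge_neq ? /edge_neq ? /edge_neq ?] _] := nbrs_edge H
    end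
  end.

Ltac use_neqs :=
  repeat match goal with
  | H : is_true (?x != ?y) |- context [?x == ?y] => rewrite (negPf H)
  | H : is_true (?y != ?x) |- context [?x == ?y] =>
      rewrite [x == y]eq_sym (negPf H)
  end.

Ltac use_nbrs :=
  repeat match goal with
  | H : nbrs ?v _ _ _ |- context [edge ?v _] => rewrite !(proj2 H)
  end.

(* Evaluates [footprinted] when all neighbourhoods of the terms are known. *)
Ltac footprints := nbrs_neqs; rewrite /footprinted /=; use_nbrs;
  rewrite ?inE ?eqxx; use_neqs; rewrite //=.

Ltac solve_edge :=
  match goal with
  | |- is_true (edge _ _) => assumption
  | |- is_true (edge _ _) => rewrite edge_sym; assumption
  | H : nbrs ?v _ _ _ |- is_true (edge ?v _) =>
      solve [rewrite (proj2 H) !inE !eqxx ?orbT //]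
  | H : nbrs ?v _ _ _ |- is_true (edge _ ?v) =>
      solve [rewrite edge_sym (proj2 H) !inE !eqxx ?orbT //]
  end.

Ltac solve_edges := repeat (apply/andP; split); by [| solve_edge].

(** * Graphs that contain Y *)

(** These terms gain 4, 1 and 1 vertices, from the last pair to the first. *)
Definition Y_foot (G : sgraph) (al be p r : G) : seq (G * G) :=
  [:: (al, be); (p, al); (r, r)].

Definition Y_list (G : sgraph) (al be p q r s : G) : seq G :=
  [:: r; s; p; q; al; be].

Section ContainsY.
Variable G : sgraph.
Hypotheses (connG : connected G) (cubG : cubic G).
Hypothesis tightG : 2 * gamma_gr G = #|G|.
Implicit Types (al be p q r s u v w x y z : G) (D C : {set G}).

Lemma Y_footprinted al be p q r s :
  @Y_at G al be p q r s -> footprinted (Y_foot al be p r).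
Proof.
case=> na np nq nr ns.
have far t t' : nbrs t t' p q -> al != t' -> be != t.
  move=> nt alt'; apply/eqP => e; have [[]] := nbrs_edge na.
  by rewrite e edge_sym (proj2 nt) !inE; nbrs_neqs; use_neqs.
have [al_r al_s] : al != r /\ al != s by nbrs_neqs.
have be_r := far _ _ nr al_s; have be_s := far _ _ ns al_r.
by rewrite /Y_foot; footprints.
Qed.

Lemma Y_sub al be p q r s a : Y_at al be p q r s ->
  a \in Y_foot al be p r -> {subset closed_nbhd a.1 <= Y_list al be p q r s}.
Proof.
case=> na np nq nr ns; rewrite !inE => /or3P[]/eqP-> w /=;
  rewrite (nbhdE na, nbhdE np, nbhdE nr) !inE -!orbA => /or4P[]/eqP->;
  by rewrite eqxx ?orbT.
Qed.

Lemma Y_saturated al be p q r s v w : Y_at al be p q r s ->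
  v \in Y_list al be p q r s -> v != be -> edge v w ->
  w \in Y_list al be p q r s.
Proof.
case=> na np nq nr ns; rewrite !inE.
case/or4P=> [/eqP->|/eqP->|/eqP->|/or3P[]/eqP->]; rewrite ?eqxx // => _;
  rewrite (proj2 na, proj2 np, proj2 nq, proj2 nr, proj2 ns) !inE => /or3P[]/eqP->;
  by rewrite eqxx ?orbT.
Qed.

Lemma Y_tight al be p q r s : Y_at al be p q r s ->
  tight [set x in Y_list al be p q r s] /\ uniq (Y_list al be p q r s).
Proof.
move=> hY; apply: (tight_list connG cubG tightG (Y_footprinted hY)) => //.
by move=> a; apply: Y_sub hY.
Qed.

(** The two copies with their attachments form a tight set.  If [be1] is [u1],
    then [be] gains only [u2] over it.  Otherwise the branch at [be] is attached
    at [be] only, so together with the first copy it is closed under adjacency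
    and, as G is connected, contains [be1]; but a branch avoids the tight
    set. *)
Lemma two_Y D al be p q r s u1 u2 al1 be1 p1 q1 r1 s1 :
  D =i Y_list al be p q r s ->
  Y_at al be p q r s -> nbrs be u1 u2 al -> ~~ edge u1 u2 ->
  u1 \notin D -> u2 \notin D ->
  Y_at al1 be1 p1 q1 r1 s1 ->
  (forall v, v \in [:: r1; s1; p1; q1; al1] -> v \notin u1 |: (u2 |: D)) ->
  be1 \notin D -> be1 != u2 -> False.
Proof.
move=> DE hY nbe ne u1D u2D hY1 out1 be1D be1u2.
have outD v : v \in [:: r1; s1; p1; q1; al1] -> v \notin D.
  by move/out1; rewrite in_setU1 in_setU1 !negb_or => /and3P[].
have foot1 a : a \in Y_foot al1 be1 p1 r1 -> a.2 \notin D.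
  rewrite !inE => /or3P[]/eqP->; [exact: be1D | |]; apply: outD;
  by rewrite !inE eqxx ?orbT.
pose l := Y_list al1 be1 p1 q1 r1 s1 ++ Y_list al be p q r s.
have [] := @tight_list _ connG cubG tightG
    (Y_foot al1 be1 p1 r1 ++ Y_foot al be p r) l => //.
- apply: footprinted_cat (Y_footprinted hY1) (Y_footprinted hY) _ => a b af bf.
  apply: contra (foot1 a af) => ab.
  by rewrite DE; apply: (Y_sub hY) bf _ ab.
- move=> a; rewrite mem_cat => /orP[af|af] w wa; rewrite mem_cat.
    by rewrite (Y_sub hY1 af wa).
  by rewrite (Y_sub hY af wa) orbT.
move=> tD _.
have inl v : (v \in [set x in l]) =
    (v \in [:: r1; s1; p1; q1; al1]) || (v == be1) || (v \in D).
  by rewrite inE mem_cat DE !inE -!orbA.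
have u1l : u1 \notin [:: r1; s1; p1; q1; al1].
  by apply/negP => /out1; rewrite in_setU1 eqxx.
have u2l : u2 \notin [:: r1; s1; p1; q1; al1].
  by apply/negP => /out1; rewrite !in_setU1 eqxx orbT.
have u2T : u2 \notin [set x in l].
  by rewrite inl (negPf u2l) (negPf u2D) eq_sym (negPf be1u2).
have beD : be \in D by rewrite DE !inE eqxx !orbT.
have alD : al \in D by rewrite DE !inE eqxx !orbT.
have beT : be \in [set x in l] by rewrite inl beD orbT.
case: (eqVneq be1 u1) => [e|ne1].
  have [|w []] := tight_step connG cubG tightG (x := be) tD _ u2T.
    by rewrite (nbhdE nbe) !inE eqxx !orbT.
  rewrite inl (nbhdE nbe) !inE -!orbA => /or4P[]/eqP->.
  - by rewrite beD !orbT.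
  - by rewrite e eqxx !orbT.
  - by rewrite eqxx.
  by rewrite alD !orbT.
have u1T : u1 \notin [set x in l].
  by rewrite inl (negPf u1l) (negPf u1D) eq_sym (negPf ne1).
have [C [dC u1C u2C clC]] :=
  branch_closed connG cubG tightG tD beT nbe u1T u2T ne.
have CT : C :|: D = setT.
  apply: (connected_closed connG (x := u1)); first by rewrite inE u1C.
  move=> v w; rewrite !in_setU => /orP[vC|vD] vw.
    by case: (clC _ _ vC vw) => ->; rewrite ?beD ?orbT.
  case: (eqVneq v be) vw => [->|vbe vw].
    by rewrite (proj2 nbe) 3!inE => /or3P[]/eqP->; rewrite ?u1C ?u2C ?alD ?orbT.
  rewrite DE in vD; rewrite orbC DE.
  by rewrite (Y_saturated hY vD vbe vw).
have := in_setT be1; rewrite -CT in_setU (negPf be1D) orbF => be1C.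
by have := disjointFr dC be1C; rewrite inl eqxx orbT.
Qed.

(** The branch at [u1] contains a copy of Y, which by [two_Y] hangs at [be]. *)
Lemma Y_arm D al be p q r s u1 u2 y z :
  D =i Y_list al be p q r s -> Y_at al be p q r s -> tight D ->
  nbrs be u1 u2 al -> ~~ edge u1 u2 -> u1 \notin D -> u2 \notin D ->
  nbrs u1 y z be -> y \notin u1 |: (u2 |: D) -> z \notin u1 |: (u2 |: D) ->
  ~~ edge y z ->
  exists p1 q1 r1 s1, Y_at u1 be p1 q1 r1 s1 /\
    forall v, v \in [:: r1; s1; p1; q1] -> v \notin u1 |: (u2 |: D).
Proof.
move=> DE hY tD nbe ne u1D u2D nu yD zD nyz; have [u12 _ _] := nbrs_neq nbe.
have beD : be \in D by rewrite DE !inE eqxx !orbT.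
have [_ tD'] := tight_pair cubG tD beD nbe u1D u2D.
have u1D' : u1 \in u1 |: (u2 |: D) by rewrite in_setU1 eqxx.
have [al1 [be1 [p1 [q1 [r1 [s1 [hY1 [pD qD rD sD] ab]]]]]]] :=
  branch_Y connG cubG tightG tD' u1D' nu yD zD nyz.
have out v : v \in [:: r1; s1; p1; q1] -> v \notin u1 |: (u2 |: D).
  by rewrite 4!inE => /or4P[]/eqP->.
case: ab hY1 => [[-> ->] hY1|[aD ab] hY1]; first by exists p1, q1, r1, s1.
have [bD bu2] : be1 \notin D /\ be1 != u2.
  case: ab => [|->] //.
  by rewrite !in_setU1 !negb_or => /and3P[_ ? ?].
case: (two_Y DE hY nbe ne u1D u2D hY1 _ bD bu2) => v vin.
have : v \in [:: r1; s1; p1; q1] ++ [:: al1] := vin.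
by rewrite mem_cat mem_seq1 => /orP[/out|/eqP->].
Qed.

(** The other neighbours [u1], [u2] of [be] are not adjacent: by [star], they
    would have a common neighbour in the copy of Y, whose degrees are exhausted.
    Either their arms meet in the
    central pair of a diamond, and G is Y_2, or each carries a copy of Y, and G
    is Y_3. *)
Lemma contains_Y al be p q r s : Y_at al be p q r s ->
  graph_iso G (coded 10 Y2_edges) \/ graph_iso G (coded 16 Y3_edges).
Proof.
move=> hY; have [tD uD] := Y_tight hY.
have [D DE {}tD] : exists2 D : {set G}, D =i Y_list al be p q r s & tight D.
  by exists [set x in Y_list al be p q r s] => // v; rewrite inE.
have [na np nq nr ns] := hY.
have beD : be \in D by rewrite DE !inE eqxx !orbT.
have [_ [bea _ _]] := nbrs_edge na.
have [u1 [u2 nx]] := nbrs_ex1 cubG bea; have nbe := nbrs_rot nx.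
have [alu1 alu2 u12] := nbrs_neq nx.
have [[beu1 beu2 _] [u1be u2be _]] := nbrs_edge nbe.
have sat v w : v \in D -> v != be -> edge v w -> w \in D.
  by rewrite !DE => vD vbe vw; apply: Y_saturated hY vD vbe vw.
have [ber bes bep beq beal] : [/\ be != r, be != s, be != p, be != q & be != al].
  have : uniq (rcons [:: r; s; p; q; al] be) := uD.
  by rewrite rcons_uniq !inE !negb_or => /andP[/and5P[]].
have fresh u : edge be u -> al != u -> u \notin D.
  move=> beu alu; have ube := edge_neq beu; rewrite edge_sym in beu.
  apply/negP; rewrite DE !inE.
  case/or4P=> [/eqP e|/eqP e|/eqP e|/or3P[]/eqP e]; move: beu alu ube;
    rewrite {}e ?eqxx // (proj2 np, proj2 nq, proj2 nr, proj2 ns) !inE; use_neqs;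
    by [].
have u1D := fresh _ beu1 alu1; have u2D := fresh _ beu2 alu2.
have [_ tD'] := tight_pair cubG tD beD nbe u1D u2D.
have ne : ~~ edge u1 u2.
  case: (star connG cubG tightG tD beD nbe u1D u2D) => [[t [tD0 n1 _]]|[] //].
  have [_ bet _] := nbrs_neq n1; have [_ [_ _ tu1]] := nbrs_edge n1.
  by rewrite eq_sym in bet; have := sat _ _ tD0 bet tu1; rewrite (negPf u1D).
have ne' : ~~ edge u2 u1 by rewrite edge_sym.
have outD v : v \notin u1 |: (u2 |: D) -> [/\ v != u1, v != u2 & v \notin D].
  by rewrite !inE !negb_or => /and3P[].
have uniqL v w : v \notin u1 |: (u2 |: D) -> w \notin u1 |: (u2 |: D) ->
    v != w -> uniq ([:: u1; u2; v; w] ++ Y_list al be p q r s).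
  move=> /outD[v1 v2 vD] /outD[w1 w2 wD] vw.
  rewrite cat_uniq uD andbT; apply/andP; split.
    by rewrite /= !inE !negb_or u12 vw ![u1 == _]eq_sym ![u2 == _]eq_sym v1 v2 w1 w2.
  apply/hasPn => t; rewrite -DE => tD0; rewrite !inE !negb_or.
  by rewrite !(contraTneq _ tD0) // => ->.
have isY2 v1 v2 y z : [:: v1; v2] = [:: u1; u2] \/ [:: v1; v2] = [:: u2; u1] ->
   nbrs v1 y z be -> nbrs v2 y z be -> nbrs y z v1 v2 ->
   nbrs z y v1 v2 -> y \notin u1 |: (u2 |: D) -> z \notin u1 |: (u2 |: D) ->
   graph_iso G (coded 10 Y2_edges).
  move=> v12 n1 n2 ny nz yD zD; have [yz _ _] := nbrs_neq n1.
  apply: (@iso_of_list G 10 _ r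
    ([:: p; q; r; s; al] ++ [:: v1; v2; y; z; be])) => //.
    have := uniqL _ _ yD zD yz; rewrite -(perm_uniq (_ : perm_eq
      ([:: p; q; r; s; al] ++ [:: v1; v2; y; z; be]) _)) //.
    by case: v12 => -[-> ->]; apply/permP => P; rewrite !count_cat /=; ring.
  by rewrite /=; solve_edges.
have [y [z [n1 yD zD [nyz|[n2 ny nz]]]]] :=
    fork connG cubG tightG tD beD nbe u1D u2D ne; last first.
  by left; apply: (isY2 u1 u2 y z); rewrite //; left.
have [y' [z' [n2 yD' zD' [nyz'|[n1' ny nz]]]]] :=
    fork connG cubG tightG tD beD (nbrs_swap nbe) u2D u1D ne'; last first.
  by rewrite setUCA in yD' zD'; left; apply: (isY2 u2 u1 y' z'); rewrite //; right.
right.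
have [p1 [q1 [r1 [s1 [hY1 out1]]]]] :=
  Y_arm DE hY tD nbe ne u1D u2D n1 yD zD nyz.
have [p2 [q2 [r2 [s2 [hY2]]]]] :=
  Y_arm DE hY tD (nbrs_swap nbe) ne' u2D u1D n2 yD' zD' nyz'.
rewrite setUCA => out2.
have [na1 np1 nq1 nr1 ns1] := hY1; have [na2 np2 nq2 nr2 ns2] := hY2.
(* The first arm is closed under adjacency apart from [u1], so a vertex
   common to both arms would put [u2] into the first. *)
have sat1 v w : v \in [:: r1; s1; p1; q1] -> edge v w ->
    w \in u1 :: [:: r1; s1; p1; q1].
  rewrite !inE => /or4P[]/eqP->;
    rewrite (proj2 np1, proj2 nq1, proj2 nr1, proj2 ns1) !inE;
    by case/or3P=> /eqP->; rewrite eqxx ?orbT.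
have u2N : u2 \notin u1 :: [:: r1; s1; p1; q1].
  rewrite in_cons negb_or eq_sym u12 /=; apply/negP => /out1.
  by rewrite !in_setU1 eqxx orbT.
have in2 v : v \in [:: r2; s2; p2; q2] -> v != u1 /\ v != u2.
  by move/out2/outD => [].
have p2N : p2 \notin [:: r1; s1; p1; q1].
  have [[e _ _] _] := nbrs_edge np2.
  by apply/negP => /sat1/(_ e); rewrite (negPf u2N).
have q2N : q2 \notin [:: r1; s1; p1; q1].
  have [[e _ _] _] := nbrs_edge nq2.
  by apply/negP => /sat1/(_ e); rewrite (negPf u2N).
have p2u1 : p2 != u1 by case: (in2 p2) => //; rewrite !inE eqxx ?orbT.
have r2N : r2 \notin [:: r1; s1; p1; q1].
  have [[_ e _] _] := nbrs_edge nr2.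
  by apply/negP => /sat1/(_ e); rewrite in_cons (negPf p2N) (negPf p2u1).
have s2N : s2 \notin [:: r1; s1; p1; q1].
  have [[_ e _] _] := nbrs_edge ns2.
  by apply/negP => /sat1/(_ e); rewrite in_cons (negPf p2N) (negPf p2u1).
have uY a p' q' r' s' : Y_at a be p' q' r' s' -> uniq [:: r'; s'; p'; q'].
  by case/Y_tight=> _ /(take_uniq 4).
pose vs := [:: p; q; r; s; al] ++ [:: p1; q1; r1; s1; u1]
  ++ [:: p2; q2; r2; s2; u2] ++ [:: be].
apply: (@iso_of_list G 16 _ r vs) => //; last by rewrite /=; solve_edges.
have pe : perm_eq vs ([:: r1; s1; p1; q1] ++ [:: r2; s2; p2; q2]
     ++ [:: u1; u2] ++ Y_list al be p q r s).
  by apply/permP => P; rewrite /vs !count_cat /=; ring.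
have /allP disj : all (fun t => t \notin [:: r1; s1; p1; q1]) [:: r2; s2; p2; q2].
  by apply/and5P; split.
have u12L : uniq ([:: u1; u2] ++ Y_list al be p q r s).
  have [yz _ _] := nbrs_neq n1; apply: subseq_uniq (uniqL _ _ yD zD yz).
  exact: (cat_subseq (prefix_subseq [:: u1; u2] [:: y; z]) (subseq_refl _)).
have far (l : seq G) : (forall v, v \in l -> v \notin u1 |: (u2 |: D)) ->
    ~~ has [in l] ([:: u1; u2] ++ Y_list al be p q r s).
  move=> out; apply/hasPn => t tL; apply/negP => /out/negP; apply.
  by move: tL; rewrite mem_cat -DE !inE orbA.
rewrite (perm_uniq pe) cat_uniq (uY _ _ _ _ _ hY1) has_cat negb_or (far _ out1).
rewrite cat_uniq (uY _ _ _ _ _ hY2) (far _ out2) u12L !andbT.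
exact/hasPn.
Qed.

End ContainsY.

(** * Graphs that contain a diamond *)

(** The central pair comes first, then the ends. *)
Definition diamond_at (G : sgraph) (r s p q : G) : bool :=
  [&& p != q, edge r s, edge r p, edge r q, edge s p & edge s q].

Section ContainsDiamond.
Variable G : sgraph.
Hypotheses (connG : connected G) (cubG : cubic G).
Hypothesis tightG : 2 * gamma_gr G = #|G|.
Implicit Types (p q r s u v w x y z : G) (D C : {set G}).

(** This excludes K_4: there one term dominates everything, whereas half the
    order is 2. *)
Lemma nbhd_proper x : closed_nbhd x <> setT.
Proof.
have n4 v : closed_nbhd v = setT -> #|G| = 4.
  by move=> e; rewrite -cardsT -e card_nbhd.
move=> e; have [s ls] := gamma_legal G; have G4 := n4 _ e.
have /eqP : 2 * gamma_gr G = 2 * 2 by rewrite tightG G4.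
rewrite eqn_mul2l => /= /eqP -> sz.
case: s ls sz => [|a [|b [|]]] //= /and3P[/negP + _ _] _; apply.
rewrite dominated_cons dominated_nil setU0.
have -> : closed_nbhd b = setT; last exact: subsetT.
by apply/eqP; rewrite eqEcard subsetT cardsT G4 card_nbhd.
Qed.

Lemma diamond_nbrs r s p q : diamond_at r s p q ->
  nbrs r s p q /\ nbrs s r p q.
Proof.
case/and5P=> pq rs rp rq /andP[sp sq].
split; apply: nbrs_intro => //; last by rewrite edge_sym.
  by rewrite /= !inE negb_or pq !edge_neq.
by rewrite /= !inE negb_or pq !edge_neq.
Qed.

(** If the ends [p], [q] of the diamond have the same outer neighbour, there is
    a copy of Y.  Otherwise [r], [p], [q] gain 4, 1 and 1 vertices and dominate
    a tight set; by [star] at [p'], either the outer neighbours [p'], [q'] are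
    the ends of a second diamond or there is a branch, hence a copy of Y. *)
Lemma contains_diamond r s p q : diamond_at r s p q ->
  [\/ graph_iso G (coded 10 Y2_edges), graph_iso G (coded 16 Y3_edges)
    | graph_iso G (coded 8 NYY_edges)].
Proof.
move=> dia; have [nr ns] := diamond_nbrs dia.
have Ycase : (exists al be p q r s, @Y_at G al be p q r s) ->
    [\/ graph_iso G (coded 10 Y2_edges), graph_iso G (coded 16 Y3_edges)
      | graph_iso G (coded 8 NYY_edges)].
  case=> [? [? [? [? [? [?]]]]]] /(contains_Y connG cubG tightG)[]; by constructor.
have [[rs rp rq] [sr pr qr]] := nbrs_edge nr.
have [[_ sp sq] [_ ps qs]] := nbrs_edge ns.
have npq : ~~ edge p q.
  apply/negP => pq; apply: (@nbhd_proper r).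
  have np : nbrs p r s q.
    by apply: nbrs_intro; rewrite //= !inE negb_or !edge_neq.
  have nq : nbrs q r s p.
    by apply: nbrs_intro; rewrite //= 1?edge_sym // !inE negb_or !edge_neq.
  apply: (connected_closed connG (nbhd_refl r)) => v w.
  rewrite (nbhdE nr) !inE -!orbA => /or4P[]/eqP->;
    rewrite (proj2 nr, proj2 ns, proj2 np, proj2 nq) !inE => /or3P[]/eqP->;
    by rewrite eqxx ?orbT.
have r_s := edge_neq rs.
have [p' np] := nbrs_ex2 cubG r_s pr ps.
have [q' nq] := nbrs_ex2 cubG r_s qr qs.
case: (eqVneq p' q') => [e|p'q'].
  apply: Ycase; rewrite -e in nq.
  have [[_ _ pp'] [_ _ p'p]] := nbrs_edge np.
  have [[_ _ _] [_ _ p'q]] := nbrs_edge nq.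
  have [pq _ _] := and3P dia.
  have [be nb] := nbrs_ex2 cubG pq p'p p'q.
  exists p', be, p, q, r, s; split=> //; do ?exact/nbrs_rot/nbrs_rot.
have [pq _ _] := and3P dia.
have [[_ _ pp'] [_ _ p'p]] := nbrs_edge np.
have [[_ _ qq'] [_ _ q'q]] := nbrs_edge nq.
have q'_p : q' != p by apply: contraNneq npq => <-; rewrite edge_sym.
have p'_q : p' != q by apply: contraNneq npq => <-.
pose l := [:: r; s; p; q; p'; q'].
have [] := @tight_list _ connG cubG tightG [:: (q, q'); (p, p'); (r, r)] l => //.
- by footprints.
- move=> a; rewrite !inE => /or3P[]/eqP-> w /=;
    rewrite (nbhdE nr, nbhdE np, nbhdE nq) !inE -!orbA => /or4P[]/eqP->;
    by rewrite eqxx ?orbT.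
move=> tD ul.
have [D DE {}tD] : exists2 D : {set G}, D =i l & tight D.
  by exists [set x in l] => // v; rewrite inE.
have sat v w : v \in [:: r; s; p; q] -> edge v w -> w \in D.
  rewrite DE !inE => /or4P[]/eqP->;
    rewrite (proj2 nr, proj2 ns, proj2 np, proj2 nq) !inE => /or3P[]/eqP->;
    by rewrite eqxx ?orbT.
have Dcase v : v \in D -> [\/ v \in [:: r; s; p; q], v = p' | v = q'].
  rewrite DE -[l]/([:: r; s; p; q] ++ [:: p'; q']) mem_cat.
  by case/orP=> [|]; [constructor | rewrite !inE => /orP[]/eqP->; constructor].
have [y [z np']] := nbrs_ex1 cubG p'p.
have [[_ p'y p'z] [_ yp' zp']] := nbrs_edge np'; have [py pz yz] := nbrs_neq np'.
have p'D : p' \in D by rewrite DE !inE eqxx !orbT.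
have q'D : q' \in D by rewrite DE !inE eqxx !orbT.
have pD : p \in D by rewrite DE !inE eqxx !orbT.
have saturated v : v \in [:: r; s; p; q] -> edge v p' -> v = p.
  rewrite !inE => /or4P[]/eqP->;
    rewrite (proj2 nr, proj2 ns, proj2 np, proj2 nq) !inE;
    nbrs_neqs; use_neqs; by [].
have fresh y0 z0 : nbrs p' p y0 z0 -> y0 \notin D.
  move=> n; have [[_ p'y0 p'z0] [_ y0p' z0p']] := nbrs_edge n.
  have [py0 pz0 yz0] := nbrs_neq n; apply/negP => /Dcase[vl|e|e].
  - by have := saturated _ vl y0p'; apply/eqP; rewrite eq_sym.
  - by rewrite e edge_irrefl in p'y0.
  have z0D : z0 \notin D.
    apply/negP => /Dcase[vl|e'|e'].
    - by have := saturated _ vl z0p'; apply/eqP; rewrite eq_sym.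
    - by rewrite e' edge_irrefl in p'z0.
    by rewrite e e' eqxx in yz0.
  have [|w []] := tight_step connG cubG tightG (x := p') tD _ z0D.
    by rewrite (nbhdE n) !inE eqxx !orbT.
  by rewrite (nbhdE n) !inE -!orbA => /or4P[]/eqP->; rewrite ?p'D ?pD ?e ?q'D ?eqxx.
have yD := fresh _ _ np'.
have zD : z \notin D by apply: (fresh z y); apply/nbrs_rot/nbrs_swap.
have [[t [tD0 ny nz]]|[nyz _]] := star connG cubG tightG tD p'D (nbrs_rot np') yD zD;
  last first.
  have [al [be [p1 [q1 [r1 [s1 [hY _ _]]]]]]] :=
    branch_Y connG cubG tightG tD p'D (nbrs_rot np') yD zD nyz.
  by apply: Ycase; exists al, be, p1, q1, r1, s1.
have tq' : t = q'.
  case: (Dcase _ tD0) => // [tl|e].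
    have [_ [_ _ ty]] := nbrs_edge ny.
    by have := sat _ _ tl ty; rewrite (negPf yD).
  by have [_ + _] := nbrs_neq ny; rewrite e eqxx.
rewrite {t tD0}tq' in ny nz; constructor 3.
have uyz : uniq ([:: y; z] ++ l).
  rewrite cat_uniq ul andbT; apply/andP; split; first by rewrite /= inE yz.
  apply/hasPn => t; rewrite -DE => tD0.
  by rewrite !inE negb_or !(contraTneq _ tD0) // => ->.
pose vs := [:: p; q; r; s; p'; q'; y; z].
apply: (@iso_of_list G 8 _ r vs) => //; last by rewrite /=; solve_edges.
rewrite -(perm_uniq (_ : perm_eq ([:: y; z] ++ l) vs)) //.
by apply/permP => P; rewrite /=; ring.
Qed.

End ContainsDiamond.

(** * Diamond-free graphs with a short cycle *)

Ltac split_ands :=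
  repeat match goal with H : is_true (_ && _) |- _ => case/andP: H => ? ? end.

(* Closes a goal with an adjacency that the known neighbourhoods exclude. *)
Ltac absurd_edge :=
  match goal with
  | H : is_true (edge ?v ?v) |- _ => by rewrite edge_irrefl in H
  | H : is_true (?v != ?v) |- _ => by rewrite eqxx in H
  | H : is_true (edge ?x ?y), H' : is_true (~~ edge ?x ?y) |- _ =>
      by rewrite H in H'
  | N : nbrs ?b _ _ _, H : is_true (edge ?b _) |- _ =>
      solve [exfalso; move: H; rewrite (proj2 N) !inE; use_neqs; by []]
  | N : nbrs ?b _ _ _, H : is_true (edge _ ?b) |- _ =>
      solve [exfalso; move: H; rewrite edge_sym (proj2 N) !inE; use_neqs; by []]
  end.

Ltac absurd_eq :=
  let e := fresh in apply/eqP => e; subst; absurd_edge.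

Section NoDiamond.
Variable G : sgraph.
Hypotheses (connG : connected G) (cubG : cubic G).
Hypothesis tightG : 2 * gamma_gr G = #|G|.
Hypothesis no_diamond : forall r s p q : G, ~~ diamond_at r s p q.
Implicit Types (a b c d e p q r s u v w x y z : G) (D C : {set G}).

(** Some vertex of a tight set with nonempty complement sees the complement
    twice, and both alternatives of [star] then lead to a diamond. *)
Lemma tight_full D x : tight D -> x \in D -> D = setT.
Proof.
move=> tD xD; case: (eqVneq D setT) => // /(boundary connG xD)[v [w [vD wD vw]]].
have [|w' []] := tight_step connG cubG tightG (x := v) tD _ wD.
  by rewrite in_nbhd vw orbT.
rewrite in_nbhd => /orP[/eqP->|vw' w'D]; first by rewrite vD.
rewrite eq_sym => w_w'; have [t n] := nbrs_ex2 cubG w_w' vw vw'.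
case: (star connG cubG tightG tD vD n wD w'D) => [[z [zD nw nw']]|[ne _]].
  have [[wv ww' wz] _] := nbrs_edge nw; have [[w'v _ w'z] _] := nbrs_edge nw'.
  have [_ vz _] := nbrs_neq nw.
  by case/negP: (no_diamond w w' v z); apply/and5P; split=> //; apply/andP.
have [al [be [p [q [r [s [[_ _ _ nr ns] _ _]]]]]]] :=
  branch_Y connG cubG tightG tD vD n wD w'D ne.
have [[rs rp rq] _] := nbrs_edge nr; have [[_ sp sq] _] := nbrs_edge ns.
have [_ _ pq] := nbrs_neq nr.
by case/negP: (no_diamond r s p q); apply/and5P; split=> //; apply/andP.
Qed.

Lemma full_list (f : seq (G * G)) (l : seq G) :
  footprinted f ->
  all (fun h : G * G => all (fun w => w \in l) (enum (closed_nbhd h.1))) f ->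
  0 < size f -> size l <= 2 * size f -> (forall x, x \in l) /\ uniq l.
Proof.
move=> ff /allP sub f0 sl.
have sub' (h : G * G) : h \in f -> {subset closed_nbhd h.1 <= l}.
  by move=> af w wa; apply: (allP (sub _ af)); rewrite mem_enum.
have [tD ul] := tight_list connG cubG tightG ff sub' sl; split=> // x.
case: f f0 {ff sub sl} sub' tD => // h f _ sub' tD.
have hD : h.1 \in [set x in l].
  by rewrite inE (sub' h) ?inE ?eqxx // nbhd_refl.
by have := in_setT x; rewrite -(tight_full tD hD) inE.
Qed.

Lemma all_nbhd v x y z (l : seq G) : nbrs v x y z ->
  all (fun w => w \in l) (enum (closed_nbhd v)) =
  [&& v \in l, x \in l, y \in l & z \in l].
Proof.
move=> n; rewrite (nbhdE n); apply/allP/and4P => [H|[vl xl yl zl] w].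
  by split; apply: H; rewrite mem_enum !inE eqxx ?orbT.
by rewrite mem_enum !inE -!orbA => /or4P[]/eqP->.
Qed.

End NoDiamond.

(* [full f l H U] shows with the footprints [f] that [l] lists every vertex,
   without repetition. *)
Ltac full f l H U :=
  have [H U] : (forall x, x \in l) /\ uniq l;
  [apply: (@full_list _ _ _ _ _ f l); rewrite //;
    [footprints
    | by rewrite [all _ _]/=;
         repeat match goal with N : nbrs _ _ _ _ |- _ => rewrite (all_nbhd _ N) end;
         rewrite !inE !eqxx ?orbT]
  | rewrite /= !inE !negb_or in U; split_ands].

(* Tries all positions of the vertex [y] and discards the impossible ones. *)
Ltac where_is H y :=
  have := H y; rewrite !inE;
  repeat (case/orP => [|]); move/eqP => ?; subst; try absurd_edge.

Lemma two_of (G : sgraph) (v x s t : G) : cubic G -> edge v x ->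
  (forall w, edge v w -> w \in [:: x; s; t]) -> edge v s /\ edge v t.
Proof.
move=> cubG vx H; have [y [z n]] := nbrs_ex1 cubG vx.
have [[_ vy vz] _] := nbrs_edge n; have [xy xz yz] := nbrs_neq n.
have := H y vy; have := H z vz; rewrite !inE ![_ == x]eq_sym.
rewrite (negPf xy) (negPf xz) /= => /orP[]/eqP ez /orP[]/eqP ey; subst => //.
  by rewrite eqxx in yz.
by rewrite eqxx in yz.
Qed.

Section ShortCycles.
Variable G : sgraph.
Hypotheses (connG : connected G) (cubG : cubic G).
Hypothesis tightG : 2 * gamma_gr G = #|G|.
Hypothesis no_diamond : forall r s p q : G, ~~ diamond_at r s p q.
Implicit Types (a b c d e p q r s u v w x y z : G) (D C : {set G}).

(** The outer neighbours of a triangle are distinct, as there are no diamonds,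
    and the triangle gains 4, 1 and 1 vertices. *)
Lemma triangle_prism a b c : edge a b -> edge b c -> edge a c ->
  graph_iso G (coded 6 prism_edges).
Proof.
move=> ab bc ac; have ba := ab; have ca := ac; have cb := bc.
rewrite edge_sym in ba; rewrite edge_sym in ca; rewrite edge_sym in cb.
have [a' na] := nbrs_ex2 cubG (edge_neq bc) ab ac.
have [b' nb] := nbrs_ex2 cubG (edge_neq ac) ba bc.
have [c' nc] := nbrs_ex2 cubG (edge_neq ab) ca cb.
have [[_ _ aa'] [_ _ a'a]] := nbrs_edge na.
have [[_ _ bb'] [_ _ b'b]] := nbrs_edge nb.
have [[_ _ cc'] [_ _ c'c]] := nbrs_edge nc.
have dia u v w w' : edge u v -> edge u w -> edge v w -> edge u w' -> 
    w != w' -> ~~ edge v w'.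
  move=> uv uw vw uw' ww'; apply: contra (no_diamond u v w w') => vw'.
  by apply/and5P; split=> //; apply/andP.
nbrs_neqs.
have nba' : ~~ edge b a' by apply: (dia a b c).
have nca' : ~~ edge c a' by apply: (dia a c b).
have ncb' : ~~ edge c b' by apply: (dia b c a); rewrite // eq_sym.
have a'b' : a' != b' by apply: contraNneq nba' => ->.
have a'c' : a' != c' by apply: contraNneq nca' => ->.
have b'c' : b' != c' by apply: contraNneq ncb' => ->.
pose l := [:: a; b; c; a'; b'; c'].
full [:: (c, c'); (b, b'); (a, a')] l fullG uG.
have [e1 e2] : edge a' b' /\ edge a' c'.
  by apply: two_of a'a _ => // w ?; where_is fullG w; rewrite ?eqxx ?orbT.
have [_ e3] : edge b' a' /\ edge b' c'.
  by apply: two_of b'b _ => // w ?; where_is fullG w; rewrite ?eqxx ?orbT.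
apply: (@iso_of_list G 6 _ a l) => //; last by rewrite /=; solve_edges.
rewrite /l /= !inE; use_neqs; by [].
Qed.

Hypothesis no_triangle :
  forall x y z, edge x y -> edge y z -> edge x z -> False.

Lemma common_nonadjacent x y z : edge x y -> edge x z -> ~~ edge y z.
Proof. by move=> xy xz; apply/negP => yz; apply: (no_triangle xy yz xz). Qed.

Lemma neq_of_nonadjacent x y z : ~~ edge x y -> edge x z -> z != y.
Proof. by move=> xy xz; apply: contraNneq xy => <-. Qed.

(** Two common third neighbours and one different: the third neighbour [h] of
    [g], and that of [d'] if [h] is [d'], provide the missing gain, and the
    graph then has too few vertices to complete the degrees. *)
Lemma K23_two a b c d e g d' : a != c ->
  nbrs a b d e -> nbrs c b d e -> nbrs b a c g -> nbrs e a c g ->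
  nbrs d a c d' -> d' != g -> False.
Proof.
move=> ac na nc nb ne nd d'g.
have [[ab ad ae] _] := nbrs_edge na.
have nbd := common_nonadjacent ab ad; have nbe := common_nonadjacent ab ae.
have nde := common_nonadjacent ad ae.
have ndb : ~~ edge d b by rewrite edge_sym.
have [[_ _ bg] [_ _ gb]] := nbrs_edge nb; have [[_ _ eg] [_ _ ge]] := nbrs_edge ne.
have [[_ _ dd'] [_ _ d'd]] := nbrs_edge nd.
nbrs_neqs.
have gd := neq_of_nonadjacent nbd bg.
have d'b := neq_of_nonadjacent ndb dd'; have d'e := neq_of_nonadjacent nde dd'.
have b_e : b != e by [].
have [h ng] := nbrs_ex2 cubG b_e gb ge.
have [[_ _ gh] [_ _ hg]] := nbrs_edge ng.
nbrs_neqs.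
have ha : h != a by absurd_eq.
have hc : h != c by absurd_eq.
have hd : h != d by absurd_eq.
case: (eqVneq h d') => [e'|hd'].
  subst h; have [k nd'] := nbrs_ex2 cubG gd hg d'd.
  have [[_ _ d'k] [_ _ kd']] := nbrs_edge nd'.
  nbrs_neqs.
  have ka : k != a by absurd_eq.
  have kb : k != b by absurd_eq.
  have kc : k != c by absurd_eq.
  have ke : k != e by absurd_eq.
  pose l := [:: a; b; c; d; e; g; d'; k].
  full [:: (d', k); (d, d'); (b, c); (a, a)] l fullG uG.
  have [y [z nk]] := nbrs_ex1 cubG kd'.
  have [[_ ky kz] _] := nbrs_edge nk; have [? ? ?] := nbrs_neq nk.
  by where_is fullG y.
pose l := [:: a; b; c; d; e; g; d'; h].
full [:: (g, h); (d, d'); (b, c); (a, a)] l fullG uG.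
have [y [z nd']] := nbrs_ex1 cubG d'd.
have [[_ d'y d'z] _] := nbrs_edge nd'; have [? ? ?] := nbrs_neq nd'.
by where_is fullG y; where_is fullG z.
Qed.

(** If [b], [d], [e] have distinct third neighbours, then these are all the
    other vertices, and they would form a triangle. *)
Lemma K23_K33 a b c d e : a != c -> nbrs a b d e -> nbrs c b d e ->
  graph_iso G (coded 6 K33_edges).
Proof.
move=> ac na nc; have [[ab ad ae] [ba da ea]] := nbrs_edge na.
have [[cb cd ce] [bc dc ec]] := nbrs_edge nc.
have [b' nb] := nbrs_ex2 cubG ac ba bc.
have [d' nd] := nbrs_ex2 cubG ac da dc.
have [e' ne] := nbrs_ex2 cubG ac ea ec.
have nbd := common_nonadjacent ab ad; have nbe := common_nonadjacent ab ae.
have nde := common_nonadjacent ad ae.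
have ndb : ~~ edge d b by rewrite edge_sym.
have neb : ~~ edge e b by rewrite edge_sym.
have ned : ~~ edge e d by rewrite edge_sym.
have [[_ _ bb'] [_ _ b'b]] := nbrs_edge nb.
have [[_ _ dd'] [_ _ d'd]] := nbrs_edge nd.
have [[_ _ ee'] [_ _ e'e]] := nbrs_edge ne.
case: (eqVneq b' e') => [e1|b'e'].
  subst e'; case: (eqVneq d' b') => [e2|d'b'].
    subst d'; nbrs_neqs.
    have b'd := neq_of_nonadjacent nbd bb'; have b'e := neq_of_nonadjacent nbe bb'.
    apply: (@iso_of_list G 6 _ a [:: a; c; b'; b; d; e]) => //.
      by rewrite /= !inE; use_neqs.
    by rewrite /=; solve_edges.
  by case: (K23_two ac na nc nb ne nd d'b').
case: (eqVneq d' e') => [e1|d'e'].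
  subst e'; case: (@K23_two a d c b e d' b') => //.
    exact: nbrs_swap na.
  exact: nbrs_swap nc.
case: (eqVneq b' d') => [e1|b'd'].
  subst d'; case: (@K23_two a b c e d b' e') => //.
  - exact: nbrs_rot (nbrs_swap na).
  - exact: nbrs_rot (nbrs_swap nc).
  by rewrite eq_sym.
nbrs_neqs.
have b'd := neq_of_nonadjacent nbd bb'; have b'e := neq_of_nonadjacent nbe bb'.
have d'b := neq_of_nonadjacent ndb dd'; have d'e := neq_of_nonadjacent nde dd'.
have e'b := neq_of_nonadjacent neb ee'; have e'd := neq_of_nonadjacent ned ee'.
pose l := [:: a; b; c; d; e; b'; d'; e'].
full [:: (e, e'); (d, d'); (b, b'); (a, a)] l fullG uG.
have [b'd'E b'e'E] : edge b' d' /\ edge b' e'.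
  by apply: two_of b'b _ => // w ?; where_is fullG w; rewrite ?eqxx ?orbT.
have [_ d'e'E] : edge d' b' /\ edge d' e'.
  by apply: two_of d'd _ => // w ?; where_is fullG w; rewrite ?eqxx ?orbT.
by case: (no_triangle b'd'E d'e'E b'e'E).
Qed.

End ShortCycles.

Section FourCycle.
Variable G : sgraph.
Hypotheses (connG : connected G) (cubG : cubic G).
Hypothesis tightG : 2 * gamma_gr G = #|G|.
Hypothesis no_diamond : forall r s p q : G, ~~ diamond_at r s p q.
Hypothesis no_triangle :
  forall x y z : G, edge x y -> edge y z -> edge x z -> False.
Implicit Types (a b c d e p q r s u v w x y z : G) (D C : {set G}).

(** Opposite vertices with a common outer neighbour form a K_{2,3}.  Otherwise
    the four outer neighbours are distinct, there are no other vertices, and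
    they form a 4-cycle in one of the three possible orders. *)
Lemma four_cycle a b c d :
  edge a b -> edge b c -> edge c d -> edge d a -> a != c -> b != d ->
  [\/ graph_iso G (coded 6 K33_edges), graph_iso G (coded 8 Q3_edges)
    | graph_iso G (coded 8 TQ3_edges)].
Proof.
move=> ab bc cd da ac bd.
have [ba [cb [dc ad]]] : edge b a /\ edge c b /\ edge d c /\ edge a d.
  by rewrite ![edge b a]edge_sym ![edge c b]edge_sym ![edge d c]edge_sym
             ![edge a d]edge_sym.
have [a' na] := nbrs_ex2 cubG bd ab ad.
have [b' nb] := nbrs_ex2 cubG ac ba bc.
have [c' nc] := nbrs_ex2 cubG bd cb cd.
have [d' nd] := nbrs_ex2 cubG ac da dc.
case: (eqVneq a' c') => [e|a'c'].
  subst c'; constructor 1.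
  exact: (K23_K33 connG cubG tightG no_diamond no_triangle ac na nc).
case: (eqVneq b' d') => [e|b'd'].
  subst d'; constructor 1.
  exact: (K23_K33 connG cubG tightG no_diamond no_triangle bd nb nd).
have [[_ _ aa'] [_ _ a'a]] := nbrs_edge na.
have [[_ _ bb'] [_ _ b'b]] := nbrs_edge nb.
have [[_ _ cc'] [_ _ c'c]] := nbrs_edge nc.
have [[_ _ dd'] [_ _ d'd]] := nbrs_edge nd.
have nac := common_nonadjacent no_triangle ba bc;
have nca := common_nonadjacent no_triangle bc ba.
have nbd := common_nonadjacent no_triangle ab ad;
have ndb := common_nonadjacent no_triangle ad ab.
have a'c := neq_of_nonadjacent nac aa'; have c'a := neq_of_nonadjacent nca cc'.
have b'd := neq_of_nonadjacent nbd bb'; have d'b := neq_of_nonadjacent ndb dd'.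
have na'b := common_nonadjacent no_triangle aa' ab;
have na'd := common_nonadjacent no_triangle aa' ad.
have nc'b := common_nonadjacent no_triangle cc' cb;
have nc'd := common_nonadjacent no_triangle cc' cd.
have a'b' : a' != b' by apply: contraNneq na'b => ->.
have a'd' : a' != d' by apply: contraNneq na'd => ->.
have c'b' : c' != b' by apply: contraNneq nc'b => ->.
have c'd' : c' != d' by apply: contraNneq nc'd => ->.
nbrs_neqs.
pose l := [:: a; b; c; d; a'; b'; c'; d'].
full [:: (d, d'); (c, c'); (b, b'); (a, a')] l fullG uG.
have A : [\/ edge a' b' /\ edge a' c', edge a' b' /\ edge a' d'
            | edge a' c' /\ edge a' d'].
  have [y [z n']] := nbrs_ex1 cubG a'a.
  have [[_ ? ?] _] := nbrs_edge n'; have [? ? ?] := nbrs_neq n'.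
  by where_is fullG y; where_is fullG z;
    first [by constructor 1 | by constructor 2 | by constructor 3].
have B : [\/ edge b' a' /\ edge b' c', edge b' a' /\ edge b' d'
            | edge b' c' /\ edge b' d'].
  have [y [z n']] := nbrs_ex1 cubG b'b.
  have [[_ ? ?] _] := nbrs_edge n'; have [? ? ?] := nbrs_neq n'.
  by where_is fullG y; where_is fullG z;
    first [by constructor 1 | by constructor 2 | by constructor 3].
have C : [\/ edge c' a' /\ edge c' b', edge c' a' /\ edge c' d'
            | edge c' b' /\ edge c' d'].
  have [y [z n']] := nbrs_ex1 cubG c'c.
  have [[_ ? ?] _] := nbrs_edge n'; have [? ? ?] := nbrs_neq n'.
  by where_is fullG y; where_is fullG z;
    first [by constructor 1 | by constructor 2 | by constructor 3].
have E : [\/ edge d' a' /\ edge d' b', edge d' a' /\ edge d' c'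
            | edge d' b' /\ edge d' c'].
  have [y [z n']] := nbrs_ex1 cubG d'd.
  have [[_ ? ?] _] := nbrs_edge n'; have [? ? ?] := nbrs_neq n'.
  by where_is fullG y; where_is fullG z;
    first [by constructor 1 | by constructor 2 | by constructor 3].
have ext u v w t : edge u v -> edge u w -> edge u t -> v != w -> v != t ->
    w != t -> nbrs u v w t.
  move=> uv uw ut vw vt wt; apply: nbrs_intro => //.
  by rewrite /= !inE negb_or vw vt wt.
case: A => -[e1 e2].
- have n : nbrs a' a b' c' by apply: ext; rewrite // eq_sym.
  have [d'b'E d'c'E] : edge d' b' /\ edge d' c' by case: E => -[? ?] //; absurd_edge.
  constructor 3; apply: (@iso_of_list G 8 _ a [:: a; b; c; d; a'; b'; d'; c']) => //.
    by rewrite /= !inE; use_neqs.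
  by rewrite /=; solve_edges.
- have n : nbrs a' a b' d' by apply: ext; rewrite // eq_sym.
  have [c'b'E c'd'E] : edge c' b' /\ edge c' d' by case: C => -[? ?] //; absurd_edge.
  constructor 2; apply: (@iso_of_list G 8 _ a l) => //.
    by rewrite /= !inE; use_neqs.
  by rewrite /=; solve_edges.
have n : nbrs a' a c' d' by apply: ext; rewrite // eq_sym.
have [b'c'E b'd'E] : edge b' c' /\ edge b' d' by case: B => -[? ?] //; absurd_edge.
constructor 3; apply: (@iso_of_list G 8 _ a [:: b; c; d; a; b'; c'; a'; d']) => //.
  by rewrite /= !inE; use_neqs.
by rewrite /=; solve_edges.
Qed.

End FourCycle.

Section FiveCycle.
Variable G : sgraph.
Hypotheses (connG : connected G) (cubG : cubic G).
Hypothesis tightG : 2 * gamma_gr G = #|G|.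
Hypothesis no_diamond : forall r s p q : G, ~~ diamond_at r s p q.
Hypothesis no_triangle :
  forall x y z : G, edge x y -> edge y z -> edge x z -> False.
Implicit Types (a b c d e p q r s u v w x y z : G) (D C : {set G}).

(** The outer neighbours are distinct and are all the other vertices; each of
    them avoids the outer neighbours of consecutive vertices, as there are no
    4-cycles. *)
Lemma five_cycle v0 v1 v2 v3 v4 :
  (forall a b c d, edge a b -> edge b c -> edge c d -> edge d a ->
     a != c -> b != d -> False) ->
  uniq [:: v0; v1; v2; v3; v4] ->
  edge v0 v1 -> edge v1 v2 -> edge v2 v3 -> edge v3 v4 -> edge v4 v0 ->
  graph_iso G (coded 10 petersen_edges).
Proof.
move=> noC4 uv e01 e12 e23 e34 e40.
rewrite /= !inE !negb_or in uv; split_ands.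
have [e10 [e21 [e32 [e43 e04]]]] :
  edge v1 v0 /\ edge v2 v1 /\ edge v3 v2 /\ edge v4 v3 /\ edge v0 v4.
  by do 4?split; rewrite edge_sym.
have v14 : v1 != v4 by []. have v02 : v0 != v2 by []. have v13 : v1 != v3 by [].
have v24 : v2 != v4 by []. have v30 : v3 != v0 by rewrite eq_sym.
have [w0 n0] := nbrs_ex2 cubG v14 e01 e04.
have [w1 n1] := nbrs_ex2 cubG v02 e10 e12.
have [w2 n2] := nbrs_ex2 cubG v13 e21 e23.
have [w3 n3] := nbrs_ex2 cubG v24 e32 e34.
have [w4 n4] := nbrs_ex2 cubG v30 e43 e40.
have [[_ _ f0] [_ _ g0]] := nbrs_edge n0.
have [[_ _ f1] [_ _ g1]] := nbrs_edge n1.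
have [[_ _ f2] [_ _ g2]] := nbrs_edge n2.
have [[_ _ f3] [_ _ g3]] := nbrs_edge n3.
have [[_ _ f4] [_ _ g4]] := nbrs_edge n4.
have adj x y u v : edge x y -> edge x u -> edge y v -> u != v.
  move=> xy xu yv; apply/eqP => e; subst v; exact: no_triangle xy yv xu.
have opp x t y u v : edge x t -> edge t y -> edge x u -> edge y v ->
    x != y -> t != u -> u != v.
  move=> xt ty xu yv xy tu; apply/eqP => e; subst v.
  by apply: (noC4 x t y u); rewrite // edge_sym.
nbrs_neqs.
have w01 := adj _ _ _ _ e01 f0 f1; have w12 := adj _ _ _ _ e12 f1 f2.
have w23 := adj _ _ _ _ e23 f2 f3; have w34 := adj _ _ _ _ e34 f3 f4.
have w40 := adj _ _ _ _ e40 f4 f0.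
have w02 : w0 != w2 by apply: (opp v0 v1 v2).
have w13 : w1 != w3 by apply: (opp v1 v2 v3).
have w24 : w2 != w4 by apply: (opp v2 v3 v4).
have w30 : w3 != w0 by apply: (opp v3 v4 v0).
have w41 : w4 != w1 by apply: (opp v4 v0 v1); rewrite // eq_sym.
have far x y z u : edge x y -> edge x z -> edge y u -> u != z.
  move=> xy xz yu.
  exact: neq_of_nonadjacent (common_nonadjacent no_triangle xy xz) yu.
have w0v2 := far _ _ _ _ e10 e12 f0; have w0v3 := far _ _ _ _ e40 e43 f0.
have w1v3 := far _ _ _ _ e21 e23 f1; have w1v4 := far _ _ _ _ e01 e04 f1.
have w2v4 := far _ _ _ _ e32 e34 f2; have w2v0 := far _ _ _ _ e12 e10 f2.
have w3v0 := far _ _ _ _ e43 e40 f3; have w3v1 := far _ _ _ _ e23 e21 f3.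
have w4v1 := far _ _ _ _ e04 e01 f4; have w4v2 := far _ _ _ _ e34 e32 f4.
pose l := [:: v0; v1; v2; v3; v4; w0; w1; w2; w3; w4].
full [:: (v4, w4); (v3, w3); (v2, w2); (v1, w1); (v0, w0)] l fullG uG.
have apart x y u v : edge x y -> edge x u -> edge y v -> x != v -> u != y ->
    ~~ edge u v /\ ~~ edge v u.
  move=> xy xu yv xv uy; rewrite [edge v u]edge_sym; suff: ~~ edge u v by [].
  apply/negP => uv; apply: (noC4 x y v u); rewrite 1?edge_sym //.
  - by rewrite edge_sym.
  - by rewrite edge_sym.
  by rewrite eq_sym.
have [p01 p10] : ~~ edge w0 w1 /\ ~~ edge w1 w0.
  by apply: (apart v0 v1); rewrite // eq_sym.
have [p12 p21] : ~~ edge w1 w2 /\ ~~ edge w2 w1.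
  by apply: (apart v1 v2); rewrite // eq_sym.
have [p23 p32] : ~~ edge w2 w3 /\ ~~ edge w3 w2.
  by apply: (apart v2 v3); rewrite // eq_sym.
have [p34 p43] : ~~ edge w3 w4 /\ ~~ edge w4 w3.
  by apply: (apart v3 v4); rewrite // eq_sym.
have [p40 p04] : ~~ edge w4 w0 /\ ~~ edge w0 w4.
  by apply: (apart v4 v0); rewrite // eq_sym.
have [E02 E03] : edge w0 w2 /\ edge w0 w3.
  by apply: two_of g0 _ => // w ?; where_is fullG w; rewrite ?eqxx ?orbT.
have [E13 E14] : edge w1 w3 /\ edge w1 w4.
  by apply: two_of g1 _ => // w ?; where_is fullG w; rewrite ?eqxx ?orbT.
have [E24 E20] : edge w2 w4 /\ edge w2 w0.
  by apply: two_of g2 _ => // w ?; where_is fullG w; rewrite ?eqxx ?orbT.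
have [E30 E31] : edge w3 w0 /\ edge w3 w1.
  by apply: two_of g3 _ => // w ?; where_is fullG w; rewrite ?eqxx ?orbT.
have [E41 E42] : edge w4 w1 /\ edge w4 w2.
  by apply: two_of g4 _ => // w ?; where_is fullG w; rewrite ?eqxx ?orbT.
apply: (@iso_of_list G 10 _ v0 l) => //; last by rewrite /=; solve_edges.
by rewrite /= !inE; use_neqs.
Qed.

End FiveCycle.

(** * Long shortest cycles *)

Section Girth.
Variable G : sgraph.
Implicit Types (u v w x y z : G) (c p q : seq G).

Definition is_cycle c : bool := [&& 2 < size c, uniq c & cycle (@edge G) c].

(** Growing a path at its first vertex [x] stops when all neighbours of [x] are
    on it; one of these is not the second vertex of the path. *)
Lemma cycle_exists : connected G -> cubic G -> exists c, is_cycle c.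
Proof.
move=> connG cubG.
suff H k : (exists c, is_cycle c) \/
    exists x p, [/\ size p = k, uniq (x :: p) & path (@edge G) x p].
  case: (H #|G|) => // -[x [p [sp up _]]]; have := card_uniqP up.
  by move=> e; have := max_card [in x :: p]; rewrite e /= sp ltnn.
elim: k => [|k [IH|[x [p [sp up ep]]]]]; [right | by left |].
  by have [/card_gt0P[x _] _] := connG; exists x, [::].
have [a [b [d n]]] := nbrs_ex cubG x.
have [[xa xb _] _] := nbrs_edge n; have [ab _ _] := nbrs_neq n.
have grow w : edge x w -> w \notin x :: p ->
    exists x p, [/\ size p = k.+1, uniq (x :: p) & path (@edge G) x p].
  move=> xw wp; exists w, (x :: p); split; first by rewrite /= sp.
    by rewrite cons_uniq wp.
  by rewrite /= edge_sym xw.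
case: (boolP (a \in x :: p)) => [ap|/(grow a xa)]; last by right.
case: (boolP (b \in x :: p)) => [bp|/(grow b xb)]; last by right.
left.
have [w [xw wp wh]] : exists w, [/\ edge x w, w \in p & w != head x p].
  move: ap bp; rewrite !inE.
  rewrite [a == x]eq_sym [b == x]eq_sym !(negPf (edge_neq _)) //= => ap bp.
  case: (eqVneq a (head x p)) => [e|ah]; last by exists a.
  by exists b; rewrite xb bp -e eq_sym.
case/splitPr: wp ep up wh => p1 p2.
rewrite cat_path => /andP[e1 /andP[e2 _]] up wh.
exists (x :: rcons p1 w); apply/and3P; split.
- by case: p1 wh {e1 e2 up} => [|? ?] /=; rewrite ?eqxx // size_rcons.
- by move: up; rewrite -cat_rcons -cat_cons cat_uniq => /andP[].
by rewrite /= !rcons_path e1 e2 last_rcons edge_sym.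
Qed.

Section ShortestCycle.
Variable g : nat.
Hypothesis shortest : forall c, is_cycle c -> g <= size c.

(** The path [q] closes a cycle with the arc [c1], which is not shorter than
    the whole; so [q] is at least as long as the other arc. *)
Lemma shortcut v c1 w c2 q : is_cycle (v :: c1 ++ w :: c2) ->
  size (v :: c1 ++ w :: c2) = g -> path (@edge G) w (rcons q v) -> uniq q ->
  {in q, forall x, x \notin v :: c1 ++ w :: c2} -> 0 < size c1 + size q ->
  size c2 <= size q.
Proof.
move=> /and3P[_ uc ec] sc pq uq dq c1q.
have cy : is_cycle (v :: c1 ++ w :: q).
  apply/and3P; split.
  - by rewrite /= size_cat /= addnS !ltnS.
  - move: uc; rewrite -!cat_cons !cat_uniq => /and3P[-> h1 h2] /=.
    have wq : w \notin q.
      by apply/negP => /dq; rewrite inE mem_cat inE eqxx !orbT.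
    rewrite wq uq !andbT; apply/norP; split.
      by move: h1; rewrite /= negb_or => /andP[].
    apply/hasPn => x /dq; apply: contra; rewrite -cat_cons mem_cat => ->.
    by [].
  move: ec; rewrite /= rcons_cat cat_path /= rcons_cat cat_path /= => /and3P[-> -> _].
  exact: pq.
have := shortest cy; rewrite -sc /= !size_cat /= ltnS leq_add2l.
by [].
Qed.

Lemma shortcuts v c1 w c2 q : is_cycle (v :: c1 ++ w :: c2) ->
  size (v :: c1 ++ w :: c2) = g -> path (@edge G) w (rcons q v) ->
  path (@edge G) v (rcons (rev q) w) -> uniq q ->
  {in q, forall x, x \notin v :: c1 ++ w :: c2} -> 0 < size q ->
  size c1 <= size q /\ size c2 <= size q.
Proof.
move=> cy sc pq pq' uq dq q0; split; last first.
  by apply: shortcut cy sc pq uq dq _; rewrite addn_gt0 q0 orbT.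
have rE : rot (size (v :: c1)) (v :: c1 ++ w :: c2) = w :: c2 ++ v :: c1.
  by rewrite -cat_cons rot_size_cat.
rewrite -(size_rev q); apply: (@shortcut w c2 v c1) => //.
- rewrite -rE; case/and3P: cy => s u e.
  by apply/and3P; rewrite size_rot rot_uniq rot_cycle.
- by rewrite -rE size_rot.
- by rewrite rev_uniq.
- by move=> x; rewrite mem_rev -rE mem_rot; apply: dq.
by rewrite size_rev addn_gt0 q0 orbT.
Qed.

End ShortestCycle.

Hypotheses (connG : connected G) (cubG : cubic G).
Hypothesis tightG : 2 * gamma_gr G = #|G|.
Hypothesis no_diamond : forall r s p q : G, ~~ diamond_at r s p q.

(** A chord would be a [shortcut] with empty [q]. *)
Lemma outer_neighbour g c v : (forall c', is_cycle c' -> g <= size c') ->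
  is_cycle c -> size c = g -> v \in c ->
  exists a b o, [/\ nbrs v a b o, a \in c, b \in c & o \notin c].
Proof.
move=> mg cy sc /rot_to[i t rt].
have memE x : (x \in c) = (x \in v :: t) by rewrite -rt mem_rot.
have {}sc : size (v :: t) = g by rewrite -rt size_rot.
have {i rt}cy : is_cycle (v :: t).
  by move: cy; rewrite /is_cycle -(size_rot i) -(rot_uniq i) -(rot_cycle i) rt.
have /and3P[s3 uc ec] := cy.
case: t memE sc cy s3 uc ec => [|a t] // memE sc cy s3 uc ec.
case/lastP: t memE sc cy s3 uc ec => [|t b] // memE sc cy s3 uc ec.
have va : edge v a by case/andP: ec.
have bv : edge v b.
  by move: ec; rewrite edge_sym /= !rcons_path last_rcons => /and3P[].
have ab : a != b.
  by move: uc; rewrite /= mem_rcons inE negb_or => /and3P[_ /andP[]].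
have [o n] := nbrs_ex2 cubG ab va bv; exists a, b, o; split=> //.
- by rewrite memE !inE eqxx orbT.
- by rewrite memE !inE mem_rcons inE eqxx !orbT.
have [_ ao bo] := nbrs_neq n; have [[_ _ vo] [_ _ ov]] := nbrs_edge n.
apply/negP; rewrite memE !inE mem_rcons inE eq_sym (negPf (edge_neq vo)) /=.
rewrite eq_sym (negPf ao) eq_sym (negPf bo) /= => ot.
case/splitPr: ot memE sc cy {s3 uc ec} => t1 t2.
rewrite rcons_cat /= => memE sc cy.
suff : size (rcons t2 b) <= size (Nil G) by rewrite size_rcons.
by apply: (@shortcut _ mg v (a :: t1) o) => //=; rewrite ov.
Qed.

(** Suppose that a shortest cycle has length at least 6.  By [shortcuts] two of
    its vertices do not share their outer neighbour, so the cycle and its outer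
    neighbours are all the vertices.  Hence the outer neighbour of [v] is
    adjacent to two others; by [shortcuts] the arcs between the feet have at
    most two inner vertices, so that both feet are antipodal to [v]. *)
Lemma girth_le5 c : is_cycle c ->
  (forall v0 v1 v2, edge v0 v1 -> edge v1 v2 -> edge v2 v0 -> False) ->
  (forall v0 v1 v2 v3, edge v0 v1 -> edge v1 v2 -> edge v2 v3 -> edge v3 v0 ->
     v0 != v2 -> v1 != v3 -> False) ->
  (forall v0 v1 v2 v3 v4, uniq [:: v0; v1; v2; v3; v4] -> edge v0 v1 ->
     edge v1 v2 -> edge v2 v3 -> edge v3 v4 -> edge v4 v0 -> False) ->
  False.
Proof.
move=> + noC3 noC4 noC5; have [n] := ubnP (size c).
elim: n c => // n IH c cn cy.
have short c' : is_cycle c' -> size c <= size c'.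
  move=> cy'; rewrite leqNgt; apply/negP => c'c; apply: IH cy'.
  exact: leq_trans c'c _.
have g6 : 5 < size c.
  case: c cy {cn short} => [|v0 [|v1 [|v2 [|v3 [|v4 [|v5 c]]]]]] // /and3P[_ uc].
  - by rewrite /= andbT => /and3P[e1 e2 e3]; case: (noC3 v0 v1 v2).
  - rewrite /= andbT => /and4P[e1 e2 e3 e4]; case: (noC4 v0 v1 v2 v3) => //.
      by move: uc; rewrite /= !inE !negb_or => /and3P[/and3P[]].
    by move: uc; rewrite /= !inE !negb_or => /and3P[_ /andP[]].
  by rewrite /= andbT => /and5P[*]; case: (noC5 v0 v1 v2 v3 v4).
pose out v := odflt v [pick w | edge v w && (w \notin c)].
have outP v : v \in c -> [/\ edge v (out v), out v \notin c &
    forall w, edge v w -> w \in c \/ w = out v].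
  move=> vc; have [a [b [o [n' ac bc oc]]]] :=
    outer_neighbour short cy (erefl _) vc.
  have [[_ _ vo] _] := nbrs_edge n'.
  rewrite /out; case: pickP => [w /andP[vw wc]|/(_ o)]; last by rewrite vo oc.
  split=> // x; rewrite (proj2 n') !inE => /or3P[]/eqP->; try by left.
  right; move: vw; rewrite (proj2 n') !inE => /or3P[]/eqP e //.
    by rewrite e ac in wc.
  by rewrite e bc in wc.
have arcs v c1 w c2 : forall i, rot i c = v :: c1 ++ w :: c2 ->
   forall q, path (@edge G) w (rcons q v) -> path (@edge G) v (rcons (rev q) w) ->
   uniq q -> {in q, forall x, x \notin c} -> 0 < size q ->
   [/\ size c1 <= size q, size c2 <= size q & size c = (size c1 + size c2).+2].
  move=> i ri q pq pq' uq dq q0.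
  have sc : size (v :: c1 ++ w :: c2) = size c by rewrite -ri size_rot.
  have cy' : is_cycle (v :: c1 ++ w :: c2).
    by move: cy; rewrite /is_cycle -(size_rot i) -(rot_uniq i) -(rot_cycle i) ri.
  have [|s1 s2] := shortcuts short cy' sc pq pq' uq _ q0.
    by move=> x xq; rewrite -ri mem_rot dq.
  by split=> //; rewrite -sc /= size_cat /= addnS.
have split_rot v w : v \in c -> w \in c -> v != w ->
    exists i c1 c2, rot i c = v :: c1 ++ w :: c2.
  move=> vc wc vw; case: (rot_to vc) => i t ri.
  have : w \in v :: t by rewrite -ri mem_rot.
  rewrite inE eq_sym (negPf vw) /= => /splitPr wt.
  by case: wt ri => c1 c2 ri; exists i, c1, c2.
have out_inj v w : v \in c -> w \in c -> out v = out w -> v = w.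
  move=> vc wc o_eq; apply/eqP; apply: contraTT g6 => vw; rewrite -leqNgt.
  have [i [c1 [c2 ri]]] := split_rot _ _ vc wc vw.
  have [vo oc _] := outP v vc; have [wo _ _] := outP w wc; rewrite -o_eq in wo.
  case: (arcs _ _ _ _ _ ri [:: out v]) => //=.
  - by rewrite wo edge_sym vo.
  - by rewrite vo edge_sym wo.
  - by move=> x; rewrite inE => /eqP->.
  move=> s1 s2 ->; rewrite !ltnS.
  by apply: leq_trans (leq_add s1 s2) _.
have uc : uniq c by case/and3P: cy.
pose f := [seq (v, out v) | v <- c].
have [] := @tight_list _ connG cubG tightG f (c ++ map out c).
- apply/andP; split.
    by rewrite all_map; apply/allP => v /outP[vo _ _]; rewrite /= vo orbT.
  rewrite pairwise_map; move: uc; rewrite uniq_pairwise.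
  apply: (sub_in_pairwise (P := [in c])); last by apply/allP.
  move=> v w vc wc /= vw; have [vo oc _] := outP v vc; have [_ _ wN] := outP w wc.
  apply/negP => /orP[/eqP e|/wN[]]; first by rewrite e wc in oc.
    by rewrite (negPf oc).
  by move/(out_inj _ _ vc wc)/eqP; rewrite (negPf vw).
- move=> _ /mapP[v vc ->] w; rewrite in_nbhd mem_cat => /orP[/eqP->|].
    by rewrite vc.
  have [_ _ vN] := outP v vc; case/vN => ->; first by [].
  by rewrite map_f ?orbT.
- by rewrite size_cat !size_map mul2n addnn.
move=> tD _; have [v vc] : exists v, v \in c.
  by case: (c) g6 => // v t _; exists v; rewrite inE eqxx.
have allG x : x \in c \/ exists2 w, w \in c & x = out w.
  have vD : v \in [set x in c ++ map out c] by rewrite inE mem_cat vc.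
  have := in_setT x; rewrite -(tight_full connG cubG tightG no_diamond tD vD).
  by rewrite inE mem_cat => /orP[|/mapP]; [left | right].
have [vo oc vN] := outP v vc; have ov := vo; rewrite edge_sym in ov.
have [y1 [y2 n']] := nbrs_ex1 cubG ov.
have [[_ oy1 oy2] _] := nbrs_edge n'; have [vy1 vy2 y12] := nbrs_neq n'.
have [i t ri] := rot_to vc.
have opposite y : edge (out v) y -> v != y -> y = out (nth v t 2).
  move=> oy vy; case: (allG y) => [yc|[w wc yw]].
    rewrite edge_sym in oy; have [_ _ yN] := outP y yc.
    case: (yN _ oy) => [|/(out_inj _ _ vc yc)/eqP]; first by rewrite (negPf oc).
    by rewrite (negPf vy).
  have [wo oc' _] := outP w wc; rewrite -yw in wo oc'.
  have vw : v != w.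
    by apply/eqP => e; rewrite yw -e edge_irrefl in oy.
  have : w \in v :: t by rewrite -ri mem_rot.
  rewrite inE eq_sym (negPf vw) /= yw => /splitPr wt.
  case: wt ri => c1 c2 ri; congr (out _).
  case: (arcs _ _ _ _ _ ri [:: y; out v]) => //=.
  - by rewrite wo edge_sym oy edge_sym vo.
  - by rewrite vo oy edge_sym wo.
  - by rewrite inE andbT eq_sym; apply: edge_neq.
  - by move=> x; rewrite !inE => /orP[]/eqP->.
  move=> s1 s2 sc; have s1E : size c1 = 2.
    apply/eqP; rewrite eqn_leq s1 -(leq_add2r (size c2)).
    by move: g6; rewrite sc !ltnS; apply: leq_trans; rewrite leq_add2l.
  by rewrite nth_cat s1E.
by case/eqP: y12; rewrite (opposite _ oy1 vy1) (opposite _ oy2 vy2).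
Qed.

End Girth.

(** * The classification *)

Lemma tight_classification (G : sgraph) :
  connected G -> cubic G -> 2 * gamma_gr G = #|G| ->
  [\/ graph_iso G (coded 6 K33_edges), graph_iso G (coded 6 prism_edges)
    | graph_iso G (coded 10 petersen_edges)] \/
  [\/ graph_iso G (coded 10 Y2_edges), graph_iso G (coded 16 Y3_edges),
      graph_iso G (coded 8 NYY_edges) | graph_iso G (coded 8 Q3_edges)] \/
  graph_iso G (coded 8 TQ3_edges).
Proof.
move=> connG cubG tightG.
case: (boolP [exists r : G, [exists s, [exists p, [exists q, diamond_at r s p q]]]]).
  case/existsP=> r /existsP[s /existsP[p /existsP[q]]].
  case/(contains_diamond connG cubG tightG) => iso; right; left.
  - by constructor 1.
  - by constructor 2.
  by constructor 3.
move=> dia; have no_diamond r s p q : ~~ @diamond_at G r s p q.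
  apply: contra dia => d; apply/existsP; exists r; apply/existsP; exists s.
  by apply/existsP; exists p; apply/existsP; exists q.
case: (boolP [exists x : G, [exists y, [exists z,
    [&& edge x y, edge y z & edge x z]]]]).
  case/existsP=> x /existsP[y /existsP[z /and3P[xy yz xz]]]; left; constructor 2.
  exact: (triangle_prism connG cubG tightG no_diamond xy yz xz).
move=> tri; have no_triangle (x y z : G) :
    edge x y -> edge y z -> edge x z -> False.
  move=> xy yz xz; case/negP: tri; apply/existsP; exists x; apply/existsP.
  by exists y; apply/existsP; exists z; rewrite xy yz.
case: (boolP [exists a : G, [exists b, [exists c, [exists d,
    [&& edge a b, edge b c, edge c d, edge d a & (a != c) && (b != d)]]]]]).
  case/existsP=> a /existsP[b /existsP[c /existsP[d]]].
  case/and5P=> ab bc cd da /andP[ac bd].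
  case: (four_cycle connG cubG tightG no_diamond no_triangle ab bc cd da ac bd).
  - by move=> iso; left; constructor 1.
  - by move=> iso; right; left; constructor 4.
  by right; right.
move=> c4; have noC4 (a b c d : G) : edge a b -> edge b c -> edge c d ->
    edge d a -> a != c -> b != d -> False.
  move=> ab bc cd da ac bd; case/negP: c4; apply/existsP; exists a.
  apply/existsP; exists b; apply/existsP; exists c; apply/existsP; exists d.
  by rewrite ab bc cd da ac bd.
case: (boolP [exists a : G, [exists b, [exists c, [exists d, [exists e,
    [&& uniq [:: a; b; c; d; e], edge a b, edge b c, edge c d
      & edge d e && edge e a]]]]]]).
  case/existsP=> a /existsP[b /existsP[c /existsP[d /existsP[e]]]].
  case/and5P=> u ab bc cd /andP[de ea]; left; constructor 3.
  exact: (five_cycle connG cubG tightG no_diamond no_triangle noC4 u ab bc cd de ea).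
move=> c5; have noC5 (a b c d e : G) : uniq [:: a; b; c; d; e] -> edge a b ->
    edge b c -> edge c d -> edge d e -> edge e a -> False.
  move=> u ab bc cd de ea; case/negP: c5; apply/existsP; exists a.
  apply/existsP; exists b; apply/existsP; exists c; apply/existsP; exists d.
  by apply/existsP; exists e; rewrite u ab bc cd de ea.
have [c cy] := cycle_exists connG cubG.
case: (girth_le5 connG cubG tightG no_diamond cy _ noC4 noC5) => x y z xy yz zx.
by apply: (no_triangle x y z); rewrite // edge_sym.
Qed.

Lemma coded_tight (G H : sgraph) n l :
  graph_iso (coded n l) H -> 2 * gamma_gr (coded n l) = n ->
  graph_iso G H -> 2 * gamma_gr G = #|G|.
Proof.
move=> cH gc GH; rewrite (iso_gamma GH) -(iso_gamma cH) gc.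
by rewrite (graph_iso_card GH) -(graph_iso_card cH) card_ord.
Qed.

Theorem corollary4p6 (G : sgraph) :
  connected G -> cubic G ->
  (2 * gamma_gr G = #|G| <->
     graph_iso G (complete_bipartite 3 3) \/ graph_iso G Y2 \/
     graph_iso G Y3 \/ graph_iso G N_YY \/ graph_iso G prism \/
     graph_iso G Q3 \/ graph_iso G TQ3 \/ graph_iso G petersen).
Proof.
move=> connG cubG; split=> [tightG|].
  have to H K : graph_iso H K -> graph_iso G H -> graph_iso G K.
    by move=> HK GH; apply: graph_iso_trans GH HK.
  have := tight_classification connG cubG tightG.
  have := (to _ _ iso_K33, to _ _ iso_Y2, to _ _ iso_Y3, to _ _ iso_NYY,
    to _ _ iso_prism, to _ _ iso_Q3, to _ _ iso_TQ3, to _ _ iso_petersen).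
  by case=> -[[[[[[k y2] y3] n] p] q] t] pt; case=> [[]|[[]|]]; tauto.
case=> [|[|[|[|[|[|[]]]]]]]; move: G {connG cubG} => G.
- by apply: coded_tight iso_K33 _; rewrite gamma_K33.
- by apply: coded_tight iso_Y2 _; rewrite gamma_Y2.
- by apply: coded_tight iso_Y3 _; rewrite gamma_Y3.
- by apply: coded_tight iso_NYY _; rewrite gamma_NYY.
- by apply: coded_tight iso_prism _; rewrite gamma_prism.
- by apply: coded_tight iso_Q3 _; rewrite gamma_Q3.
- by apply: coded_tight iso_TQ3 _; rewrite gamma_TQ3.
by apply: coded_tight iso_petersen _; rewrite gamma_petersen.
Qed.
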